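(* Let $\alpha,\gamma\in\mathbb{Z}$ with $\gamma>0$, $\alpha^\gamma\neq1$, and let $p$ be an odd prime dividing $\alpha^\gamma-1$; if $p=3$ assume $\alpha^\gamma\not\equiv7\bmod9$. Suppose that $\alpha\not\equiv\pm1\bmod p$. Then $N_p=Z_3(J)$ and $G_p/N_p\cong\mathrm{Heis}(\mathbb{Z}/p^m\mathbb{Z})$, the Heisenberg group over $\mathbb{Z}/p^m\mathbb{Z}$, so $G_p/N_p$ has order $p^{3m}$ and is generated by elements $a_0,b_0,c_0$ subject to the defining relations $$c_0=[a_0,b_0],\quad a_0^{c_0}=a_0,\quad b_0^{c_0}=b_0,\quad a_0^{p^m}=b_0^{p^m}=c_0^{p^m}=1,$$ and $W_p$ is a cyclic extension of $G_p/N_p$ of order $p^{3m+n}$, generated by elements $a_0,b_0,c_0,d_0$ with defining relations those above together with $$a_0^{d_0}=a_0^{\alpha^{qk}},\quad {}^{d_0}b_0=b_0^{\alpha^{qk}},\quad d_0^{p^n}=c_0^q.$$ Moreover, every element of $W_p$ can be written in one and only one way in the form $a_0^{e_1}b_0^{e_2}c_0^{e_3}d_0^{e_4}$ with $0\le e_1,e_2,e_3<p^m$, $0\le e_4<p^n$. Furthermore, the automorphism $a\leftrightarrow b$, $c\leftrightarrow c^{-1}$ of $G_p$ induces an automorphism $a_0\leftrightarrow b_0$, $c_0\leftrightarrow c_0^{-1}$ of $G_p/N_p$, which extends to an automorphism of $W_p$ via $d_0\leftrightarrow d_0^{-1}$.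
   Context: Conventions: $x^y=y^{-1}xy$, ${}^y x=yxy^{-1}$, $[x,y]=x^{-1}y^{-1}xy$; $v_p$ is the $p$-adic valuation; $\mathrm{Heis}(R)$ is the group of $3\times3$ upper unitriangular matrices over $R$. $W=\langle X,Y,Z\mid X^Z=X^\alpha,\ {}^Z Y=Y^\alpha,\ Z^\gamma=[X,Y]\rangle$ (a finite group), $G=\langle A,B\mid A^{[A,B]}=A^{\alpha^\gamma},\ {}^{[A,B]}B=B^{\alpha^\gamma}\rangle$ (known to be finite and nilpotent), and $N$ is the kernel of the homomorphism $G\to W$, $A\mapsto X$, $B\mapsto Y$. $J=G_p$ is the Sylow $p$-subgroup of $G$, $N_p=N\cap G_p$, and $W_p$ is a Sylow $p$-subgroup of $W$. $a,b$ are the images of $A,B$ under the canonical projection $G\to G_p$, and $c=[a,b]$; $a_0,b_0,c_0$ are the images of $a,b,c$ in $G_p/N_p$, and $G_p/N_p$ is identified with a normal subgroup of $W_p$ (via the map induced by $G\to W$). $Z_3(J)$ is the third term of the upper central series of $J$. $m=v_p(\alpha^\gamma-1)$, $n=v_p(\gamma)$, $\gamma=p^nk$, $q=|G/G_p|$. *)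

(* Defs.v *)
From mathcomp Require Import all_boot all_order all_algebra all_fingroup all_solvable.

Set Implicit Arguments.
Unset Strict Implicit.
Unset Printing Implicit Defensive.

Local Open Scope group_scope.

Definition expgz (gT : groupType) (x : gT) (z : int) : gT :=
  match z with
  | Posz n => x ^+ n
  | Negz n => x ^- n.+1
  end.

(* A system of relations in a list of generators, interpretable in an         *)
(* arbitrary, possibly infinite, group.                                       *)
Definition relations := forall hT : groupType, seq hT -> Prop.

(* G = < s | R >, with the specific generators s (von Dyck property). The     *)
(* library's [G \isog Grp (...)] neither names the generators nor allows      *)
(* negative exponents, and only tests against finite groups.                  *)
Definition presented (gT : finGroupType) (G : {group gT}) (s : seq gT)
    (R : relations) : Prop :=
  [/\ <<[set x in s]>> = G :> {set gT},
      R gT s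
    & forall (hT : groupType) (t : seq hT), R hT t ->
        exists2 f : gT -> hT,
          {in G &, {morph f : x y / x * y}} & map f s = t].

Definition W_rel (alpha : int) (gamma : nat) : relations := fun hT s =>
  if s is [:: x; y; z] then
    [/\ x ^ z = expgz x alpha,
        z * y * z^-1 = expgz y alpha
      & z ^+ gamma = [~ x, y]]
  else False.

Definition G_rel (alpha : int) (gamma : nat) : relations := fun hT s =>
  if s is [:: x; y] then
    x ^ [~ x, y] = expgz x (alpha ^+ gamma)%R /\
    [~ x, y] * y * [~ x, y]^-1 = expgz y (alpha ^+ gamma)%R
  else False.

Definition Heis_rel (M : nat) : relations := fun hT s =>
  if s is [:: a; b; c] then
    [/\ c = [~ a, b], a ^ c = a, b ^ c = b
      & [/\ a ^+ M = 1, b ^+ M = 1 & c ^+ M = 1]]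
  else False.

(* M = p ^ m, L = p ^ n, r = q k. *)
Definition Wp_rel (alpha : int) (M L q r : nat) : relations := fun hT s =>
  if s is [:: a; b; c; d] then
    Heis_rel M [:: a; b; c] /\
    [/\ a ^ d = expgz a (alpha ^+ r)%R,
        d * b * d^-1 = expgz b (alpha ^+ r)%R
      & d ^+ L = c ^+ q]
  else False.

(* The component in the Sylow p-subgroup of an element of a finite nilpotent  *)
(* group G = 'O_p(G) \x 'O_p^'(G).                                            *)
Definition Sylow_proj (p : nat) (gT : finGroupType) (G : {group gT}) : gT -> gT :=
  divgr 'O_p(G) 'O_p^'(G).

Section Heisenberg.

Variable R : finComUnitRingType.

Definition unitriangular (g : 'M[R]_3) : bool :=
  [forall i : 'I_3, forall j : 'I_3, (j <= i)%N ==> (g i j == (i == j)%:R%R)].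

Definition Heis : {set {'GL_3[R]}} := [set g : {'GL_3[R]} | unitriangular (GLval g)].

Lemma Heis_group_set : group_set Heis.
Proof.
apply/group_setP; split=> [|g h].
  rewrite inE; apply/forallP=> i; apply/forallP=> j; apply/implyP=> _.
  by rewrite GL_1E mxE.
rewrite !inE => /forallP gP /forallP hP.
apply/forallP=> i; apply/forallP=> j; apply/implyP=> le_ji.
have gE (k l : 'I_3) : (l <= k)%N -> GLval g k l = (k == l)%:R%R.
  by move=> le_lk; apply/eqP/(implyP (forallP (gP k) l)).
have hE (k l : 'I_3) : (l <= k)%N -> GLval h k l = (k == l)%:R%R.
  by move=> le_lk; apply/eqP/(implyP (forallP (hP k) l)).
rewrite GL_ME mxE (bigD1 i) //= gE // eqxx GRing.mul1r hE //.
rewrite big1 ?GRing.addr0 // => k ne_ki.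
have [le_ki | lt_ik] := leqP k i.
  by rewrite gE // eq_sym (negbTE ne_ki) GRing.mul0r.
rewrite hE ?(leq_trans le_ji (ltnW lt_ik)) //.
by rewrite -val_eqE /= gtn_eqF ?GRing.mulr0 // (leq_ltn_trans le_ji).
Qed.

Canonical Heis_group := Group Heis_group_set.

End Heisenberg.

(* Main.v *)
(* Write e = alpha^gamma = 1 + l and c = [a, b].  If z commutes with c,
   x^z = x^f and z y z^-1 = y^f, then evaluating [x, y^f]^z = [x^f, y] exactly
   shows that x^D lies in <y> and y^D in <x>, where
   D = f e^f - (e + ... + e^f).
   - In W take z = Z and f = alpha: D has valuation m because alpha <> 0, 1
     mod p, and since Z raises x to the power alpha and y to the power 1/alpha
     with alpha^2 <> 1 mod p, x^(p^m) = y^(p^m) = 1.  So the image of J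
     satisfies the relations of Heis(Z/p^m).
   - In J take z = c and f = e: D has valuation 2m (p > 3 is automatic), so
     a^(p^2m) and b^(p^2m) are central, whence c^(p^m) is in Z_2(J) and a^(p^m),
     b^(p^m) are in Z_3(J), so that J/Z_3(J) satisfies the same relations.
   The orders are bounded below by two permutation models.  For W this is the
   regular representation of an extension of Heis(Z/p^m) by Z.  For J it is the
   action on the cosets of <c>, written as <c> a^i b^j; there a has order
   p^(3m), which forces c to have order p^m modulo Z_3(J). *)
Require Import Defs.
From mathcomp Require Import all_boot all_order all_algebra all_fingroup all_solvable.
From mathcomp Require Import ring zify.

Set Implicit Arguments.
Unset Strict Implicit.
Unset Printing Implicit Defensive.

Import GRing.Theory.
Local Open Scope group_scope.

(** * A permutation model of the Macdonald group *)

(** The models give lower bounds on orders; the matching upper bounds come from collecting products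
    into normal words. With [H] the image of $G$ in $W$ and [P] the image of $J$, the $p$-part of
    $|W|$ has exponent at most $3m$ from [P] and at most $n$ from $Z$ modulo [H], while the model
    forces at least $3m+n$; hence both bounds are attained and the relations become presentations.
    The presentation of $J/N_p$ yields a map onto $J/Z_3(J)$, so $N_p\le Z_3(J)$. Equality follows
    once $c$ has order $p^m$ modulo $Z_3(J)$, and this is why the order of $a$ is the only quantity
    wanted from the coset model. The generator $d_0$ comes from $Z^{qk}$, a $p$-element because its
    $p^n$-th power is $c^q$. A prescribed Sylow subgroup need only contain a conjugate of it. The
    conjugating element can be chosen in the image of the $p'$-part of $G$, which centralizes [P],
    so the relations with $a_0,b_0,c_0$ survive. The prime 3 drops out because $\alpha$ is none of
    $0,1,-1$ modulo $p$. *)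

Lemma perm_of_fibration (T U : finType) (k : T -> U) (f : T -> T) :
  (forall x y, k x = k y <-> k (f x) = k (f y)) ->
  exists g : {perm U},
    (forall x, g (k x) = k (f x)) /\ (forall u, u \notin codom k -> g u = u).
Proof.
move=> kf.
(* One direction of [kf] makes [g] well defined on the image of [k], the other makes it injective
   there. Off the image [g] is the identity, so the classes need no type of their own. *)
pose g u := if [pick x | k x == u] is Some x then k (f x) else u.
have gE x : g (k x) = k (f x).
  rewrite /g; case: pickP => [y /eqP /kf //|/(_ x)]; by rewrite eqxx.
have gN u : u \notin codom k -> g u = u.
  rewrite /g; case: pickP => [y /eqP <-|//]; by rewrite codom_f.
have g_inj : injective g.
  move=> u v.
  have [/codomP[x ->]|nu] := boolP (u \in codom k);
  have [/codomP[y ->]|nv] := boolP (v \in codom k); rewrite ?gE ?gN //.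
  - by move=> /(kf x y).2.
  - by move=> Ev; rewrite -Ev codom_f in nv.
  - by move=> Eu; rewrite Eu codom_f in nu.
by exists (perm g_inj); split=> [x|u nu]; rewrite permE ?gE ?gN.
Qed.

Section MacdonaldModel.
Local Open Scope ring_scope.
Variables (R : finComNzRingType) (L : R).
Hypothesis L3 : L^+3 = 0.
Implicit Types e : R * R.

(* The pair [(i, j)] stands for the coset [<c> a^i b^j], with a ^ c = a ^ (1 + l),
   and a, b, c act by right multiplication; in J,
     <c> a^i b^j a = <c> a^((i + 1) (1 + l)^-j) b^((1 + l) + ... + (1 + l)^j).
   These are its coordinates modulo l^3.  Writing l = 24 L clears all
   denominators.  Since a^(l^2) b^(l^2) is trivial in J, [(i, j)] and
   [(i + t, j + t)] are identified when L t = 0. *)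
Definition coset_actA e : R * R :=
  ((e.1 + 1) * (1 - 24 * L * e.2 + 288 * L^+2 * e.2 * (e.2+1)),
   e.2 + 12 * L * (e.2^+2 + e.2) + 96 * L^+2 * (e.2^+3 - e.2)).
Definition coset_actB e : R * R := (e.1, e.2 + 1).
Definition coset_actC e : R * R :=
  ((1 + 24 * L) * e.1, (1 - 24 * L + 576 * L^+2) * e.2).
Definition coset_class e : R * R := (L * e.2, e.1 - e.2).
(* The coordinates of the same coset in the form [<c> b^j a^i], in which the
   action of a is a translation. *)
Definition coset_swap (e : R * R) : R * R :=
  let: (i, j) := e in
  (i + 12 * L * j * i * (i + 1)
     + L^+2 * (i * j * (- 408 - 72 * j + 96 * j^+2 - 360 * i + 72 * i * j
                        - 48 * i^+2 + 144 * i^+2 * j)),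
   j - 12 * L * i * (j^+2 + j)).
Local Notation k := coset_class.
Local Notation th := coset_swap.

Lemma coset_actAB e : coset_actB (coset_actA e)
  = coset_actC (coset_actA (coset_actB e)).
Proof.
by case: e => i j; rewrite /coset_actA /coset_actB /coset_actC /=; congr pair; ring: L3.
Qed.

Lemma coset_classP e e' : k e = k e' <-> 
  exists2 t, L * t = 0 & e' = (e.1 + t, e.2 + t).
Proof.
case: e e' => [i j] [i' j']; rewrite /k /=; split=> [[E1 E2]|[t Lt [-> ->]]].
  exists (j' - j); first by rewrite mulrBr E1 subrr.
  have E : i' = i - j + j' by rewrite E2 subrK.
  by rewrite E; congr pair; ring.
by congr pair; ring: Lt.
Qed.

Lemma coset_class_swap e e' : k e = k e' <-> k (th e) = k (th e').
Proof.
split=> [/coset_classP[t Lt ->]|].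
  case: e => i j; rewrite /k /th /=; congr pair; ring: Lt.
case: e e' => i j [i' j'].
have [x ->] : exists x, i' = i + x by exists (i' - i); ring.
have [y ->] : exists y, j' = j + y by exists (j' - j); ring.
pose g1 a b : R := 12 * a * (b^+2 + b).
pose g2 a b : R := 12 * b * a * (a + 1) + 12 * a * (b^+2 + b).
pose g3 a b : R :=
  a * b * (- 408 - 72 * b + 96 * b^+2 - 360 * a + 72 * a * b
           - 48 * a^+2 + 144 * a^+2 * b).
have gE (g : R -> R -> R) : [\/ g = g1, g = g2 | g = g3] ->
    forall c, c * x = 0 -> c * y = 0 -> c * g (i + x) (j + y) = c * g i j.
  move=> gdef c cx cy; have -> : c * g (i + x) (j + y) = c * g (i + x) j.
    by case: gdef => ->; rewrite ?/g1 ?/g2 ?/g3; ring: cy.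
  by case: gdef => ->; rewrite ?/g1 ?/g2 ?/g3; ring: cx.
rewrite /k /th /= => -[/eqP + /eqP].
rewrite -subr_eq0 => /eqP E1; rewrite -subr_eq0 => /eqP E2.
(* The difference [(x, y)] is determined by descending powers of [L]: multiplied by [L^+2] all
   correction terms die, then by [L], then with no factor. Each level uses [gE] with a coefficient
   already known to kill [x] and [y]. *)
have Ly2 : L^+2 * y = 0 by rewrite -(mulr0 (- L)) -[in RHS]E1; ring: L3.
have Lx2 : L^+2 * x = 0.
  by rewrite -[RHS]Ly2 -[LHS]addr0 -(mulr0 (L^+2)) -E2; ring: L3.
have Ly : L * y = L^+2 * g1 (i + x) (j + y) - L^+2 * g1 i j.
  by rewrite -[LHS]addr0 -E1 /g1; ring.
rewrite (gE g1) ?subrr // in Ly; last exact: Or31.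
have Lx : L * x = L * y - (L^+2 * g2 (i + x) (j + y)
                - L^+2 * g2 i j).
  by rewrite -[LHS]addr0 -(mulr0 L) -E2 /g2; ring: L3.
rewrite (gE g2) ?Ly ?subrr // in Lx; last exact: Or32.
have xy : x = y - (L * g2 (i + x) (j + y)
              - L * g2 i j)
           - (L^+2 * g3 (i + x) (j + y) - L^+2 * g3 i j).
  by rewrite -[LHS]addr0 -E2 /g2 /g3; ring.
rewrite (gE g2) ?(gE g3) ?subrr ?subr0 // in xy; [|exact: Or33|exact: Or32].
by rewrite xy; congr pair; [ring: Ly|ring].
Qed.

Lemma coset_swapA e : k (th (coset_actA e)) = ((k (th e)).1, (k (th e)).2 + 1).
Proof.
by case: e => i j; rewrite /coset_actA /k /th /=; congr pair; ring: L3.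
Qed.

Lemma coset_swapC e : k (th (coset_actC e)) = k (coset_actC (th e)).
Proof.
by case: e => i j; rewrite /coset_actC /k /th /=; congr pair; ring: L3.
Qed.

(** For the converse, both cosets are rewritten by [coset_swap], where [a] is a translation and
    cancels. *)
Lemma coset_class_A e e' : k e = k e' <-> k (coset_actA e) = k (coset_actA e').
Proof.
split=> [/coset_classP[t Lt ->]|].
  by case: e => i j; rewrite /k /coset_actA /=; congr pair; ring: L3 Lt.
move=> /(coset_class_swap _ _).1; rewrite !coset_swapA => -[E1 /addIr E2].
by apply/coset_class_swap; rewrite /k E1 E2.
Qed.

Lemma coset_class_C e e' : k e = k e' <-> k (coset_actC e) = k (coset_actC e').
Proof.
split=> [/coset_classP[t Lt ->]|].
  by case: e => i j; rewrite /k /coset_actC /=; congr pair; ring: L3 Lt.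
case: e e' => i j [i' j'].
have [x ->] : exists x, i' = i + x by exists (i' - i); ring.
have [y ->] : exists y, j' = j + y by exists (j' - j); ring.
rewrite /k /coset_actC => -[/eqP + /eqP].
rewrite -subr_eq0 => /eqP E1; rewrite -subr_eq0 => /eqP E2.
have Ly : L * y = 0.
  by rewrite -(mulr0 (- (1 + 24 * L))) -[in RHS]E1; ring: L3.
have Lx : L * x = 0.
  by rewrite -(mulr0 (- L * (1 - 24 * L + 576 * L^+2))) -[in RHS]E2; ring: L3 Ly.
have xy : x = y.
  have : x = y - 24 * (L * x) - (24 - 576 * L) * (L * y).
    by rewrite -[LHS]addr0 -E2; ring.
  by rewrite Lx Ly !mulr0 !subr0.
by rewrite xy /=; congr pair; [ring: Ly|ring].
Qed.

Lemma coset_class_B e e' : k e = k e' <-> k (coset_actB e) = k (coset_actB e').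
Proof.
case: e e' => i j [i' j']; rewrite /k /coset_actB /= !mulrDr !mulr1 !opprD !addrA.
by split=> -[]; [move=> -> -> | move=> /addIr -> /addIr ->].
Qed.

Local Open Scope group_scope.

(** In the application [R] is the ring of integers modulo $p^{3m}$ and [L] is a multiple of $p^m$.
    In swapped coordinates [a ^+ n] adds [n] to the second component of the class, whence the
    statement on the order of [a]. *)
Lemma macdonald_model (e : nat) : (e%:R = 1 + 24 * L)%R ->
  exists a b : {perm R * R},
    [/\ a ^ [~ a, b] = a ^+ e, [~ a, b] * b * [~ a, b]^-1 = b ^+ e
      & forall n, a ^+ n = 1 -> n%:R = 0%R :> R].
Proof.
move=> eE.
have [a [aE aN]] := perm_of_fibration coset_class_A.
have [b [bE bN]] := perm_of_fibration coset_class_B.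
have [c [cE cN]] := perm_of_fibration coset_class_C.
have permk (g h : {perm R * R}) : (forall x, g (k x) = h (k x)) ->
    (forall u, u \notin codom k -> g u = h u) -> g = h.
  move=> gh1 gh2; apply/permP => u.
  by have [/codomP[x ->]|/gh2] := boolP (u \in codom k).
have XN (g : {perm R * R}) n u : g u = u -> (g ^+ n) u = u.
  by move=> gu; elim: n => [|n IH]; rewrite ?perm1 // expgSr permM IH.
have bX n x : (b ^+ n) (k x) = k (x.1, x.2 + n%:R)%R.
  elim: n => [|n IH]; first by rewrite perm1 addr0 -surjective_pairing.
  by rewrite expgSr permM IH bE /coset_actB /= -addrA natr1.
have aX n x : exists2 y, (a ^+ n) (k x) = k y &
    k (th y) = ((k (th x)).1, (k (th x)).2 + n%:R)%R.
  elim: n => [|n [y yE thy]].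
    by exists x; rewrite ?perm1 ?addr0 -?surjective_pairing.
  exists (coset_actA y); first by rewrite expgSr permM yE aE.
  by rewrite coset_swapA thy /= -addrA natr1.
have cR : c = [~ a, b].
  apply: (mulgI (b * a)); rewrite -commgC.
  apply: permk => [x|u uN]; rewrite !permM.
    by rewrite bE aE cE aE bE coset_actAB.
  by rewrite bN // aN // cN // bN.
exists a, b; rewrite -cR; split.
- apply: (mulgI c); rewrite -conjgC.
  apply: permk => [x|u uN]; last first.
    by rewrite !permM aN // !cN // XN ?aN.
  rewrite !permM aE !cE; have [y -> thy] := aX e (coset_actC x).
  (* [coset_swapA] fixes the swapped pair only up to a diagonal shift [t] killed by [L]; the shift
     disappears again in the class after [coset_actC]. *)
  have [t Lt Et] : exists2 t, (L * t = 0)%R & th (coset_actA x) = ((th x).1 + 1 + t,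
    (th x).2 + t)%R.
    have : k (th (coset_actA x)) = k ((th x).1 + 1, (th x).2)%R.
      by rewrite coset_swapA /k /=; congr pair; ring.
    by move/esym/coset_classP.
  apply/coset_class_swap; rewrite thy !coset_swapC Et eE /k /=.
  by congr pair; ring: L3 Lt.
- apply: (mulIg c); rewrite mulgVK.
  apply: permk => [x|u uN]; last first.
    by rewrite !permM cN // bN // XN ?bN // cN.
  rewrite !permM cE bX !bE cE eE /coset_actB /coset_actC /k /=.
  by congr pair; ring: L3.
- move=> n an1; have [y] := aX n (0, 0)%R.
  rewrite an1 perm1 => /coset_class_swap -> /(congr1 snd)/esym/(canRL (addKr _)) ->.
  by rewrite addNr.
Qed.
End MacdonaldModel.

(** * A permutation model of the Wamsley group *)

Section WamsleyModel.
Variables (f M gamma : nat).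
Hypotheses (M_gt1 : (1 < M)%N) (gamma_gt0 : (0 < gamma)%N).
Hypothesis fX : (f ^ gamma = 1 %[mod M])%N.
Local Notation N := (gamma * M)%N.
Local Open Scope ring_scope.
Let u : 'Z_M := f%:R.
(** This is the inverse of [u], by [fX]. *)
Let v : 'Z_M := u ^+ gamma.-1.

Let uX : u ^+ gamma = 1.
Proof. by rewrite -natrX -[1]/(1%:R); apply/ord_inj; rewrite !val_Zp_nat. Qed.

Let uv : u * v = 1.
Proof. by rewrite -exprS prednK. Qed.

Let vX : v ^+ gamma = 1.
Proof. by rewrite exprAC uX expr1n. Qed.

Let N_gt1 : (1 < N)%N.
Proof. by rewrite (leq_trans M_gt1) // leq_pmull. Qed.

Let pow_modN (w : 'Z_M) n : w ^+ gamma = 1 -> w ^+ (n %% N) = w ^+ n.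
Proof. by move=> wX; apply: expr_mod; rewrite exprM wX expr1n. Qed.

Let powD (w : 'Z_M) (e e' : 'Z_N) : w ^+ gamma = 1 ->
  w ^+ (e + e')%R = w ^+ e * w ^+ e'.
Proof.
by move=> wX; rewrite -exprD /= [X in (_ %% X)%N](Zp_cast N_gt1) pow_modN.
Qed.

(** Since $Z^\gamma=[X,Y]$, the central coordinate of the Heisenberg group is stored in the exponent
    of $Z$, as a multiple of [gamma]. *)
Let g (x : 'Z_M) : 'Z_N := (gamma * x)%:R.

Let gE n : g n%:R = (gamma * n)%:R.
Proof.
apply/ord_inj; rewrite /g !val_Zp_nat //.
by rewrite muln_modr modn_mod.
Qed.

Let gD x y : g (x + y) = g x + g y.
Proof.
by rewrite -[x]natr_Zp -[y]natr_Zp -natrD !gE mulnDr natrD.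
Qed.

Let gMn x n : g (x *+ n) = g x *+ n.
Proof.
elim: n => [|n IH]; last by rewrite !mulrSr gD IH.
by rewrite !mulr0n -[0 in LHS]/(0%:R) gE muln0.
Qed.

Let powg (w : 'Z_M) (x : 'Z_M) (e : 'Z_N) : w ^+ gamma = 1 -> w ^+ (e + g x)%R = w ^+ e.
Proof.
move=> wX; rewrite powD // /g val_Zp_nat // pow_modN // exprM wX expr1n.
by rewrite mulr1.
Qed.

Let pow1 (w : 'Z_M) (e : 'Z_N) : w ^+ gamma = 1 -> w ^+ (e + 1)%R = w ^+ e * w.
Proof.
move=> wX; rewrite powD //= [X in (_ %% X)%N](Zp_cast N_gt1) pow_modN //.
Qed.

(* Right multiplication by X, Y, Z in the group with the law
   (x, y, d)(x', y', d') =
     (x + v^d x', y + u^d y', d + d' + gamma x u^d y'). *)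
Let T : finType := ('Z_M * 'Z_M * 'Z_N)%type.
Let fX_ (t : T) : T := (t.1.1 + v ^+ t.2, t.1.2, t.2).
Let fY_ (t : T) : T := (t.1.1, t.1.2 + u ^+ t.2, t.2 + g (t.1.1 * u ^+ t.2)).
Let fZ_ (t : T) : T := (t.1, t.2 + 1).

Let fX_inj : injective fX_.
Proof.
move=> [[x y] e] [[x' y'] e'] /eqP; rewrite /fX_ !xpair_eqE /=.
by case/andP=> /andP[/eqP Ex /eqP ->] /eqP Ee; move: Ex; rewrite Ee => /addIr ->.
Qed.

Let fY_inj : injective fY_.
Proof.
move=> [[x y] e] [[x' y'] e'] /eqP; rewrite /fY_ !xpair_eqE /=.
case/andP=> /andP[/eqP -> /eqP Ey] /eqP Ee.
have Eu : u ^+ e = u ^+ e' by rewrite -(powg (x' * u ^+ e)) // Ee powg.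
by move: Ey Ee; rewrite Eu => /addIr -> /addIr ->.
Qed.

Let fZ_inj : injective fZ_.
Proof.
move=> [t e] [t' e'] /eqP; rewrite /fZ_ xpair_eqE /= => /andP[/eqP ->].
by move=> /eqP /addIr ->.
Qed.

(** The orbit of the origin is the whole set, and an orbit length divides the group order. This
    takes the place of a proof that the law of the model is associative. *)
Lemma wamsley_model :
  exists X Y Z : {perm 'Z_M * 'Z_M * 'Z_N},
    [/\ (X ^ Z = X ^+ f)%g, (Z * Y * Z^-1 = Y ^+ f)%g, (Z ^+ gamma = [~ X, Y])%g
      & (M * M * N %| #|<<[set X; Y; Z]>>%g|)%N].
Proof.
pose X : {perm T} := perm fX_inj; pose Y : {perm T} := perm fY_inj.
pose Z : {perm T} := perm fZ_inj.
have XE n t : (X ^+ n)%g t = (t.1.1 + v ^+ t.2 *+ n, t.1.2, t.2).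
  elim: n => [|n IH]; first by rewrite expg0 perm1 addr0; case: t => [[]].
  by rewrite expgSr permM IH permE /fX_ /= -addrA mulrSr.
have YE n t : (Y ^+ n)%g t = (t.1.1, t.1.2 + u ^+ t.2 *+ n, t.2 + g (t.1.1 * u ^+ t.2)
  *+ n).
  elim: n => [|n IH]; first by rewrite expg0 perm1 !addr0; case: t => [[]].
  rewrite expgSr permM IH permE /fY_ /= -!addrA !mulrSr.
  have -> : u ^+ (t.2 + g (t.1.1 * u ^+ t.2) *+ n)%R = u ^+ t.2.
    elim: n {IH} => [|n IH]; first by rewrite addr0.
    by rewrite mulrSr addrA powg.
  by [].
have ZE n t : (Z ^+ n)%g t = (t.1, t.2 + n%:R).
  elim: n => [|n IH]; first by rewrite expg0 perm1 !addr0; case: t => [[]].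
  by rewrite expgSr permM IH permE /fZ_ /= -!addrA mulrSr.
exists X, Y, Z; split.
- apply: (mulgI Z); rewrite -conjgC; apply/permP=> -[[x y] e].
  rewrite !permM XE !permE /fX_ /fZ_ /= pow1 // -mulrnAr.
  by rewrite -[v *+ f]mulr_natl uv mulr1.
- apply: (mulIg Z); rewrite mulgVK; apply/permP=> -[[x y] e].
  rewrite !permM YE !permE /fY_ /fZ_ /= pow1 //.
  have uE (w : 'Z_M) : w * u = w *+ f by rewrite mulr_natr.
  by rewrite uE mulrnAr gMn addrAC.
- apply: (mulgI (Y * X)%g); rewrite -commgC; apply/permP=> -[[x y] e].
  rewrite !permM ZE !permE /fX_ /fY_ /= powg //.
  congr (_, _); rewrite mulrDl gD -exprMn.
  have g1 : g 1 = gamma%:R by rewrite -[1 in LHS]/(1%:R) gE muln1.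
  by rewrite (mulrC v) uv expr1n g1 addrA.
pose t0 : T := (0, 0, 0).
pose G := <<[set X; Y; Z]>>%G.
have [XG YG ZG] : [/\ X \in G, Y \in G & Z \in G].
  by split; rewrite mem_gen // !inE eqxx ?orbT.
have <- : #|orbit 'P%act G t0| = (M * M * N)%N.
  have -> : orbit 'P%act G t0 = [set: T].
    apply/setP=> -[[x y] e]; rewrite inE.
    have XE' n a b (d : 'Z_N) : (X ^+ n)%g (a, b, d) = (a + v ^+ d *+ n, b, d).
      exact: XE.
    have YE' n a b (d : 'Z_N) :
        (Y ^+ n)%g (a, b, d) = (a, b + u ^+ d *+ n, d + g (a * u ^+ d) *+ n).
      exact: YE.
    have ZE' n a (d : 'Z_N) : (Z ^+ n)%g (a, d) = (a, d + n%:R) by exact: ZE.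
    (* The point is reached by [Z ^+ e0 * X ^+ k * Y ^+ l]. The last factor shifts the
       [Z]-coordinate by [g (x * u ^+ e *+ l)], so [e0] is [e] corrected in advance; powers of [u]
       and [v] do not see this shift. *)
    pose l : nat := (y * v ^+ e)%R.
    have [e0 eE] : exists e0, e = e0 + g (x * u ^+ e *+ l).
      by exists (e - g (x * u ^+ e *+ l)); rewrite subrK.
    have uE : u ^+ e = u ^+ e0 by rewrite {1}eE powg.
    have vE : v ^+ e = v ^+ e0 by rewrite {1}eE powg.
    have uvE n : u ^+ n * v ^+ n = 1 by rewrite -exprMn uv expr1n.
    pose k : nat := (x * u ^+ e0)%R.
    apply/orbitP; exists (Z ^+ (e0 : nat) * X ^+ k * Y ^+ l)%g.
      by rewrite !groupM ?groupX.
    rewrite [LHS]apermE !permM ZE' add0r natr_Zp XE' YE' !add0r.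
    rewrite -[v ^+ _ *+ k]mulr_natl natr_Zp -[_ ^+ _ *+ l]mulr_natl natr_Zp.
    rewrite -mulrA uvE mulr1 vE -mulrA [v ^+ _ * _]mulrC uvE mulr1.
    by rewrite -gMn -uE -eE.
  by rewrite cardsT !card_prod !card_ord !Zp_cast.
exact: dvdn_orbit.
Qed.
End WamsleyModel.

(** * Words in groups *)

Lemma expgz_nat (hT : groupType) (x : hT) (z : int) (n N : nat) :
  x ^+ N = 1 -> (z = n %[mod N])%Z -> expgz x z = x ^+ n.
Proof.
move=> xN.
have dvd_eq m : (N %| m)%N -> x ^+ m = 1.
  by case/dvdnP=> k ->; rewrite mulnC expgnA xN expg1n.
case: z => [m|m] /= Emod.
  have {}Emod : (m = n %[mod N])%N.
    by move/eqP: Emod; rewrite !modz_nat => /eqP[].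
  have xmod i : x ^+ i = x ^+ (i %% N).
    by rewrite {1}(divn_eq i N) expgnDr mulnC expgnA xN expg1n mul1g.
  by rewrite xmod Emod -xmod.
have dN : (N %| m.+1 + n)%N.
  have /eqP : (Negz m == n %[mod N])%Z by apply/eqP.
  move/eqP; rewrite eqz_mod_dvd NegzE -opprD dvdzE abszN => H.
  by rewrite -PoszD in H.
by apply: mulg1_eq; rewrite -expgnDr; apply: dvd_eq.
Qed.

(* [geom e i] is the exponent in [(x * c) ^+ i = c ^+ i * x ^+ geom e i],
   where [x ^ c = x ^+ e]. *)
Definition geom (e i : nat) : nat := (\sum_(k < i) e ^ k.+1)%N.

Lemma geomS e i : geom e i.+1 = (e * (geom e i).+1)%N.
Proof.
by rewrite /geom big_ord_recl expn1 mulnS big_distrr; congr (_ + _)%N.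
Qed.

Lemma geomSr e i : geom e i.+1 = (geom e i + e ^ i.+1)%N.
Proof. by rewrite /geom big_ord_recr. Qed.

Lemma geom_le e i : (0 < e)%N -> (geom e i <= i * e ^ i)%N.
Proof.
move=> e_gt0; rewrite /geom -[X in (X * _)%N]card_ord -sum_nat_const.
by apply: leq_sum => k _; rewrite leq_pexp2l.
Qed.

(** The number $D$ attached to $e$ and $f$. The subtraction is not truncated when [e] is positive,
    by [geom_le]. *)
Definition geom_defect e f : nat := (f * e ^ f - geom e f)%N.

Section Words.
Variable hT : groupType.
Implicit Types x y z c : hT.

Lemma conj_pow x z e i j : x ^ z = x ^+ e -> (x ^+ i) ^ (z ^+ j) = x ^+ (i * e ^ j)%N.
Proof.
move=> xz; elim: j => [|j IH]; first by rewrite conjg1 muln1.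
by rewrite expgSr conjgM IH conjXg xz -expgnA expnS mulnCA.
Qed.

Lemma mulg_pow x c e i : x ^ c = x ^+ e -> (x * c) ^+ i = c ^+ i * x ^+ geom e i.
Proof.
move=> xc; elim: i => [|i IH]; first by rewrite /geom big_ord0 mulg1.
rewrite expgSr IH -mulgA [x ^+ _ * _]mulgA -expgSr.
rewrite [_ * c]conjgC conjXg xc mulgA -expgSr.
by rewrite -expgnA geomS.
Qed.

(** Since [x ^ y] is [x * [~ x, y]], its powers are given by [mulg_pow]. *)
Lemma pow_conj x y e i :
  x ^ [~ x, y] = x ^+ e -> (x ^+ i) ^ y = [~ x, y] ^+ i * x ^+ geom e i.
Proof. by move=> xc; rewrite conjXg -(mulg_pow _ xc) commgEl mulKVg. Qed.

(* Both sides come from evaluating [[x, y ^+ f] ^ z = [x ^+ f, y]] with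
   [pow_conj]. *)
Lemma pow_defect x y z e f : (0 < e)%N ->
  x ^ [~ x, y] = x ^+ e -> [~ x, y] * y * [~ x, y]^-1 = y ^+ e ->
  x ^ z = x ^+ f -> z * y * z^-1 = y ^+ f -> commute z [~ x, y] ->
  (y ^+ geom_defect e f) ^ (z * [~ x, y] ^+ f) = x ^- geom_defect e f.
Proof.
move=> e_gt0 xc yc xz yz zc; set c := [~ x, y] in xc yc zc *.
set D := geom_defect e f.
have geD : (geom e f + D = f * e ^ f)%N by rewrite subnKC // geom_le.
have cI : [~ y, x] = c^-1 by rewrite invgR.
have yc' : y ^ [~ y, x] = y ^+ e by rewrite cI conjgE invgK mulgA yc.
have yfz : (y ^+ f) ^ z = y by rewrite -yz conjgE !mulgA mulVg mul1g mulgVK.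
have xfy : [~ x ^+ f, y] = c ^+ f * x ^- D.
  rewrite commgEl (pow_conj f xc) -/c mulgA [x ^- f * _]conjgC -mulgA; congr (_ * _).
  by rewrite conjVg (conj_pow _ _ xc) -geD expgnDr invgM mulgVK.
have xyf : [~ x, y ^+ f] = y ^+ D * c ^+ f.
  rewrite commgEr conjVg (pow_conj f yc') cI expVgn invgM invgK -mulgA.
  have -> : c ^+ f * y ^+ f = y ^+ (f * e ^ f)%N * c ^+ f.
    by rewrite -(conj_pow _ _ yc') cI expVgn conjgE invgK !mulgA mulgVK.
  by rewrite -geD expgnDr !mulgA mulVg mul1g.
have : [~ x, y ^+ f] ^ z = [~ x ^+ f, y] by rewrite conjRg xz yfz.
rewrite xyf xfy conjMg [(c ^+ f) ^ z]conjXg.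
have -> : c ^ z = c by rewrite conjgE -zc mulKg.
by move=> E; rewrite conjgM conjgE E mulKg.
Qed.

(* The two generators of a group of class two are collected by moving [a ^+ i]
   to the left, which produces [[b, a] ^+ (j * i)], a power of [c ^+ M.-1]. *)
Definition normal_word (a b c d : hT) (i j k l : nat) : hT :=
  a ^+ i * b ^+ j * c ^+ k * d ^+ l.

Section NormalWords.
Variables (M L q A B : nat) (a b c d : hT).
Hypotheses (M_gt0 : (0 < M)%N) (AB : (A * B = 1 %[mod M])%N).
Hypotheses (cE : c = [~ a, b]) (ac : a ^ c = a) (bc : b ^ c = b).
Hypotheses (aM : a ^+ M = 1) (bM : b ^+ M = 1) (cM : c ^+ M = 1).
Hypotheses (ad : a ^ d = a ^+ A) (bd : d * b * d^-1 = b ^+ A).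
Hypothesis (dL : d ^+ L = c ^+ q).
Local Notation NF := (normal_word a b c d).

Let modM x i : x ^+ M = 1 -> x ^+ (i %% M)%N = x ^+ i.
Proof. by move=> xM; rewrite [in RHS](divn_eq i M)
  expgnDr mulnC expgnA xM expg1n mul1g. Qed.

Let commac : commute a c.
Proof. by apply/commgP/conjg_fixP. Qed.

Let commbc : commute b c.
Proof. by apply/commgP/conjg_fixP. Qed.

Let aAB i : a ^+ (i * (A * B))%N = a ^+ i.
Proof. by rewrite -modM // -modnMmr AB modnMmr muln1 modM. Qed.

Let bAB i : b ^+ (i * (A * B))%N = b ^+ i.
Proof. by rewrite -modM // -modnMmr AB modnMmr muln1 modM. Qed.

Let cAB : c ^+ (A * B)%N = c.
Proof. by rewrite -modM // AB modM. Qed.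

Let dV x : x ^ d^-1 = d * x * d^-1.
Proof. by rewrite conjgE invgK mulgA. Qed.

Let aB : a ^ d^-1 = a ^+ B.
Proof. by apply: (canLR (conjgK d)); rewrite conjXg ad -expgnA -[(A * B)%N]mul1n aAB. Qed.

Let bB : b ^ d = b ^+ B.
Proof.
apply: (can_inj (conjgK d^-1)); rewrite conjgK conjXg dV bd -expgnA.
by rewrite -(mul1n (A * B)%N) bAB.
Qed.

(** Conjugation by [d] raises [a] to the power [A] and [b] to the inverse power [B], so it sends [c]
    to [c ^+ (A * B)], which is [c]. *)
Let cd : c ^ d = c.
Proof.
rewrite {1}cE conjRg ad bB commgEl.
have aX n : a ^ (b ^+ n) = a * c ^+ n.
  elim: n => [|n IH]; first by rewrite conjg1 mulg1.
  rewrite expgSr conjgM IH conjMg conjXg [c ^ b]conjgE -commbc mulKg.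
  by rewrite -[a ^ b](mulKVg a) -commgEl -cE -mulgA -expgS.
rewrite conjXg aX expgMn; last exact: commuteX.
by rewrite mulKg -expgnA mulnC cAB.
Qed.

Let ba i j : b ^+ j * a ^+ i = a ^+ i * b ^+ j * c ^+ (M.-1 * (j * i))%N.
Proof.
have bX n : b ^ (a ^+ n) = b * c^-1 ^+ n.
  elim: n => [|n IH]; first by rewrite conjg1 mulg1.
  rewrite expgSr conjgM IH conjMg conjXg [c^-1 ^ a]conjgE.
  rewrite -(commuteV commac : a * _ = _) mulKg.
  by rewrite -[b ^ a](mulKVg b) -commgEl -invgR -cE -mulgA -expgS.
rewrite conjgC conjXg bX expgMn; last exact/commuteX/commuteV.
have cV : c^-1 = c ^+ M.-1 by apply: mulg1_eq; rewrite -expgS prednK.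
by rewrite cV mulgA -!expgnA; congr (_ * c ^+ _); rewrite [(j * i)%N]mulnC.
Qed.

(** Moving [d ^+ l] to the right multiplies the exponents of [a] and [b] by [B ^ l] and [A ^ l]. The
    resulting exponents depend on the parameters only and not on the group, which is what
    [presented_normal] exploits. *)
Lemma normal_wordM i j k l i' j' k' l' :
  NF i j k l * NF i' j' k' l' =
  NF (i + i' * B ^ l) (j + j' * A ^ l) (k + k' + M.-1 * (j * (i' * B ^ l))) (l + l').
Proof.
have aBl n : (a ^+ n) ^ (d^-1 ^+ l) = a ^+ (n * B ^ l)%N by apply: conj_pow.
have bAl n : (b ^+ n) ^ (d^-1 ^+ l) = b ^+ (n * A ^ l)%N.
  by apply: conj_pow; rewrite dV.
have cdl n : c ^+ n * d ^+ l = d ^+ l * c ^+ n.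
  by apply: commuteX2; apply/commgP/conjg_fixP.
have dl x : d ^+ l * x = x ^ (d^-1 ^+ l) * d ^+ l.
  by rewrite conjgE !expVgn invgK mulgA mulgVK.
rewrite /normal_word.
have -> : a ^+ i * b ^+ j * c ^+ k * d ^+ l *
    (a ^+ i' * b ^+ j' * c ^+ k' * d ^+ l') =
  a ^+ i * b ^+ j * c ^+ k * (a ^+ (i' * B ^ l)%N * b ^+ (j' * A ^ l)%N * c ^+ k')
   * (d ^+ l * d ^+ l').
  rewrite -!mulgA; do 3!congr (_ * _); rewrite !mulgA dl aBl.
  rewrite -!mulgA; congr (_ * _); rewrite !mulgA dl bAl.
  by rewrite -!mulgA; congr (_ * _); rewrite !mulgA cdl.
rewrite -expgnDr; congr (_ * _).
move: (i' * B ^ l)%N (j' * A ^ l)%N => r s.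
have ca m n : c ^+ m * a ^+ n = a ^+ n * c ^+ m by apply/commuteX2.
have cb m n : c ^+ m * b ^+ n = b ^+ n * c ^+ m by apply/commuteX2.
rewrite !mulgA -(mulgA _ (c ^+ k)) ca mulgA -(mulgA (a ^+ i)) ba !mulgA -expgnDr.
rewrite -!mulgA; congr (_ * _); rewrite !mulgA.
rewrite -(mulgA _ (c ^+ k)) cb mulgA -(mulgA (b ^+ j)) cb mulgA -expgnDr.
by rewrite -!mulgA -!expgnDr; rewrite [(_ + (k + k'))%N]addnC.
Qed.

Lemma normal_word_mod i j k l : (0 < L)%N ->
  NF i j k l = NF (i %% M) (j %% M) ((k + q * (l %/ L)) %% M) (l %% L).
Proof.
move=> L_gt0; rewrite /normal_word !modM //.
rewrite {1}(divn_eq l L) expgnDr mulnC expgnA dL -expgnA mulgA -(mulgA _ (c ^+ k)).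
by rewrite -expgnDr.
Qed.

End NormalWords.
End Words.

Section NormalPresentation.
Variables (alpha : int) (M L q r A B : nat).
Hypotheses (M_gt0 : (0 < M)%N) (L_gt0 : (0 < L)%N).
Hypotheses (alphaA : ((alpha ^+ r)%R = A %[mod M])%Z) (AB : (A * B = 1 %[mod M])%N).
Local Notation E := ('I_M * 'I_M * 'I_M * 'I_L)%type.

Let cardE : #|[set: E]| = (M ^ 3 * L)%N.
Proof. by rewrite cardsT !card_prod !card_ord !(expnSr _ 2) -mulnn. Qed.

Definition normal_of (hT : groupType) (a b c d : hT) (e : E) : hT :=
  let: (e1, e2, e3, e4) := e in normal_word a b c d e1 e2 e3 e4.

(** The third entry contains a carry: by [d ^+ L = c ^+ q], each full [L] in the exponent of [d]
    becomes [q] in that of [c]. *)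
Definition reduced_word (i j k l : nat) : E :=
  (Ordinal (ltn_pmod i M_gt0), Ordinal (ltn_pmod j M_gt0),
   Ordinal (ltn_pmod (k + q * (l %/ L)) M_gt0), Ordinal (ltn_pmod l L_gt0)).

Lemma Wp_rel_normal_wordM (hT : groupType) (a b c d : hT) i j k l i' j' k' l' :
  Wp_rel alpha M L q r [:: a; b; c; d] ->
  normal_word a b c d i j k l * normal_word a b c d i' j' k' l' =
  normal_word a b c d (i + i' * B ^ l) (j + j' * A ^ l)
    (k + k' + M.-1 * (j * (i' * B ^ l))) (l + l').
Proof.
case=> -[cE ac bc [aM bM cM]] [ad bd dL].
rewrite (expgz_nat aM alphaA) in ad; rewrite (expgz_nat bM alphaA) in bd.
exact: (normal_wordM M_gt0 AB cE).
Qed.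

Lemma Wp_rel_normal_of (hT : groupType) (a b c d : hT) i j k l :
  Wp_rel alpha M L q r [:: a; b; c; d] ->
  normal_word a b c d i j k l = normal_of a b c d (reduced_word i j k l).
Proof. by case=> -[_ _ _ [aM bM cM]] [_ _ dL]; apply: normal_word_mod. Qed.

Variables (gT : finGroupType) (K : {group gT}) (a b c d : gT).
Hypothesis genK : <<[set x in [:: a; b; c; d]]>> = K.
Hypothesis relK : Wp_rel alpha M L q r [:: a; b; c; d].

Let aE : a = normal_word a b c d 1 0 0 0.
Proof. by rewrite /normal_word expg1 !mulg1. Qed.
Let bE : b = normal_word a b c d 0 1 0 0.
Proof. by rewrite /normal_word expg1 mul1g !mulg1. Qed.
Let cE : c = normal_word a b c d 0 0 1 0.
Proof. by rewrite /normal_word expg1 !mul1g !mulg1. Qed.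
Let dE : d = normal_word a b c d 0 0 0 1.
Proof. by rewrite /normal_word expg1 !mul1g. Qed.

(** Reduced words are closed under products, so in a finite group they form a subgroup, and it
    contains the generators. *)
Lemma normal_of_surj : K \subset [set normal_of a b c d e | e : E].
Proof.
have inS i j k l : normal_word a b c d i j k l \in [set normal_of a b c d e | e : E].
  by rewrite (Wp_rel_normal_of _ _ _ _ relK) imset_f.
have gS : group_set [set normal_of a b c d e | e : E].
  apply/group_setP; split=> [|x y /imsetP[[[[i j] k] l] _ ->]].
    by have := inS 0 0 0 0; rewrite /normal_word !mulg1.
  move=> /imsetP[[[[i' j'] k'] l'] _ ->].
  by rewrite /= (Wp_rel_normal_wordM _ _ _ _ _ _ _ _ relK).
rewrite -genK (gen_subG _ (Group gS)); apply/subsetP => x; rewrite !inE.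
by case/or4P=> /eqP ->;
  [rewrite {1}aE | rewrite {1}bE | rewrite {1}cE | rewrite {1}dE]; apply: inS.
Qed.

Lemma card_normal_le : (#|K| <= M ^ 3 * L)%N.
Proof.
apply: leq_trans (subset_leq_card normal_of_surj) _.
apply: leq_trans (leq_imset_card _ _) _.
by rewrite -cardE cardsT.
Qed.

Hypothesis cardK : (M ^ 3 * L <= #|K|)%N.

Lemma normal_of_inj : injective (normal_of a b c d).
Proof.
have /imset_injP inj : #|[set normal_of a b c d e | e in [set: E]]| == #|[set: E]|.
  rewrite eqn_leq leq_imset_card cardE (leq_trans cardK) //.
  apply: leq_trans (subset_leq_card normal_of_surj) _.
  by apply/subset_leq_card/subsetP=> _ /imsetP[e _ ->]; apply: imset_f; rewrite inE.
by move=> e e'; apply: inj; rewrite inE.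
Qed.

Lemma normal_of_unique w : w \in K ->
  exists! e : E, w = normal_of a b c d e.
Proof.
move=> /(subsetP normal_of_surj)/imsetP[e _ wE]; exists e; split=> // e'.
by rewrite wE => /normal_of_inj.
Qed.

(** By counting, distinct reduced words are distinct in [K], so each can be sent to the word with
    the same exponents in [hT]. This is multiplicative because both groups obey the same product and
    reduction rules, even when [hT] is infinite. *)
Lemma presented_normal : presented K [:: a; b; c; d] (Wp_rel alpha M L q r).
Proof.
split=> // hT [|a' [|b' [|c' [|d' [|? ?]]]]] // relT.
pose f w := if [pick e | normal_of a b c d e == w] is Some e
  then normal_of a' b' c' d' e else 1.
have fE i j k l : f (normal_word a b c d i j k l) = normal_word a' b' c' d' i j k l.
  rewrite (Wp_rel_normal_of _ _ _ _ relK) (Wp_rel_normal_of _ _ _ _ relT) /f.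
  by case: pickP => [e /eqP/normal_of_inj -> //|/(_ (reduced_word i j k l))/[!eqxx]].
exists f.
  move=> x y /(subsetP normal_of_surj)/imsetP[[[[i j] k] l] _ ->].
  move=> /(subsetP normal_of_surj)/imsetP[[[[i' j'] k'] l'] _ ->].
  by rewrite /= (Wp_rel_normal_wordM _ _ _ _ _ _ _ _ relK) !fE
             (Wp_rel_normal_wordM _ _ _ _ _ _ _ _ relT).
have -> : [:: a'; b'; c'; d'] = [seq f x | x <- [:: normal_word a b c d 1 0 0 0;
    normal_word a b c d 0 1 0 0; normal_word a b c d 0 0 1 0;
    normal_word a b c d 0 0 0 1]].
  by rewrite /= !fE /normal_word !expg1 !expg0 !mulg1 !mul1g.
by rewrite -aE -bE -cE -dE.
Qed.
End NormalPresentation.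

(** * Valuations *)

Section Valuation.
Local Open Scope ring_scope.
Variable l : nat.
Local Notation e := l.+1.
Local Notation lz := (l%:Z).

Lemma exp_mod_sqr i : exists r : int, (e ^ i)%N%:Z = 1 + i%:Z * lz + lz ^+ 2 * r.
Proof.
elim: i => [|i [r IH]]; first by exists 0; rewrite expn0; ring.
exists (r + i%:Z + lz * r); rewrite expnS PoszM IH !intS; ring.
Qed.

(** A truncated binomial expansion. The factor 2, like the 6 further on, clears the denominators of
    binomial coefficients; in each application it is prime to [p]. *)
Lemma exp_mod_cube i : exists r : int,
  2 * (e ^ i)%N%:Z = 2 + 2 * i%:Z * lz + i%:Z * (i%:Z - 1) * lz ^+ 2 + lz ^+ 3 * r.
Proof.
elim: i => [|i [r IH]]; first by exists 0; rewrite expn0; ring.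
exists (r + i%:Z * (i%:Z - 1) + lz * r); rewrite expnS PoszM mulrCA IH !intS; ring.
Qed.

Lemma geom_mod_sqr i : exists r : int,
  2 * (geom e i)%:Z = 2 * i%:Z + i%:Z * (i%:Z + 1) * lz + lz ^+ 2 * r.
Proof.
elim: i => [|i [r IH]]; first by exists 0; rewrite /geom big_ord0; ring.
have [r' Er'] := exp_mod_sqr i.+1.
exists (r + 2 * r'); rewrite geomSr PoszD mulrDr IH Er' !intS; ring.
Qed.

Lemma geom_mod_cube i : exists r : int,
  6 * (geom e i)%:Z = 6 * i%:Z + 3 * i%:Z * (i%:Z + 1) * lz
    + (i%:Z + 1) * i%:Z * (i%:Z - 1) * lz ^+ 2 + lz ^+ 3 * r.
Proof.
elim: i => [|i [r IH]]; first by exists 0; rewrite /geom big_ord0; ring.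
have [r' Er'] := exp_mod_cube i.+1.
exists (r + 3 * r'); rewrite geomSr PoszD mulrDr IH.
have -> : 6 * (e ^ i.+1)%N%:Z = 3 * (2 * (e ^ i.+1)%N%:Z) :> int by ring.
rewrite Er' !intS; ring.
Qed.

Lemma geom_defectE f : (geom_defect e f)%:Z = f%:Z * (e ^ f)%N%:Z - (geom e f)%:Z.
Proof. by rewrite /geom_defect -subzn ?geom_le // PoszM. Qed.

(** The coefficient of $l$ in $D$ is $f^2-f(f+1)/2=f(f-1)/2$. *)
Lemma geom_defect_mod_sqr f : exists r : int,
  2 * (geom_defect e f)%:Z = lz * (f%:Z * (f%:Z - 1) + lz * r).
Proof.
have [r1 E1] := exp_mod_sqr f; have [r2 E2] := geom_mod_sqr f.
exists (2 * f%:Z * r1 - r2); rewrite geom_defectE mulrBr E1 E2; ring.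
Qed.

(** For $f=e=1+l$ the coefficient $f(f-1)/2$ contains a second factor $l$, so the expansion must be
    carried one order further. *)
Lemma geom_defect_mod_cube : exists r : int,
  6 * (geom_defect e e)%:Z = lz ^+ 2 * (3 + lz * r).
Proof.
have [r1 E1] := exp_mod_cube e; have [r2 E2] := geom_mod_cube e.
exists (3 * e%:Z * r1 - r2 + 3 + e%:Z * (2 * e%:Z - 1)); rewrite geom_defectE mulrBr E2.
have -> : 6 * (e%:Z * (e ^ e)%N%:Z) = 3 * e%:Z * (2 * (e ^ e)%N%:Z) :> int by ring.
rewrite E1 !intS; ring.
Qed.
End Valuation.

Section PrimeValuation.
Variables (p : nat) (p_pr : prime p).

Lemma logn_of_int_eq (c D l k : nat) (t : int) :
  (0 < l)%N -> ~~ (p %| c)%N -> ~~ (p %| t)%Z ->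
  (c%:Z * D%:Z = l%:Z ^+ k * t)%R -> (0 < D)%N /\ logn p D = (k * logn p l)%N.
Proof.
move=> l_gt0 pc pt /(congr1 absz); rewrite !abszM abszX !absz_nat => E.
have t_gt0 : (0 < `|t|)%N by rewrite absz_gt0; apply: contraNneq pt => ->;
  rewrite dvdz0.
have c_gt0 : (0 < c)%N by case: c pc {E} => //; rewrite dvdn0.
have : (0 < c * D)%N by rewrite E muln_gt0 expn_gt0 l_gt0 t_gt0.
rewrite muln_gt0 c_gt0 /= => D_gt0; split=> //.
move: (congr1 (logn p) E); rewrite !lognM ?expn_gt0 ?l_gt0 // lognX.
by rewrite (lognE p c) (lognE p `|t|) (negPf pc) -[(p %| `|t|)%N]/(p %| t)%Z (negPf pt)
  !andbF addn0.
Qed.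

Lemma dvdz_nat (a b : nat) : (a %| b%:Z)%Z = (a %| b)%N.
Proof. by []. Qed.

Variable l : nat.
Hypotheses (l_gt0 : (0 < l)%N) (p_odd : odd p) (pl : (p %| l)%N).

Let pNdvd (c : nat) : (0 < c < p)%N -> ~~ (p %| c)%N.
Proof. by case/andP=> c0 cp; rewrite gtnNdvd. Qed.

Let p_gt2 : (2 < p)%N.
Proof. by rewrite odd_prime_gt2. Qed.

Let pe i : ~~ (p %| l.+1 ^ i.+1)%N.
Proof. by rewrite Euclid_dvdX // andbT -addn1 dvdn_addr // dvdn1 gtn_eqF ?prime_gt1.
  Qed.

Let pNdvdz (x y : int) : ~~ (p %| x)%Z -> (p %| y)%Z -> ~~ (p %| (x + y)%R)%Z.
Proof. by move=> px py; rewrite rpredDr. Qed.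

Lemma logn_geom_defect f : ~~ (p %| f * f.-1)%N ->
  (0 < geom_defect l.+1 f)%N /\ logn p (geom_defect l.+1 f) = logn p l.
Proof.
move=> pf; have [r E] := geom_defect_mod_sqr l f.
rewrite -[logn p l in RHS]mul1n.
apply: (logn_of_int_eq (c := 2) (k := 1) l_gt0 (pNdvd _) _ E) => //.
apply: pNdvdz; last by rewrite dvdz_mulr.
case: f pf {E} => [|f]; first by rewrite dvdn0.
by rewrite -[f.+1.-1]/f intS addrAC subrr add0r -intS -PoszM.
Qed.

Lemma logn_geom_defect_diag : (3 < p)%N ->
  (0 < geom_defect l.+1 l.+1)%N /\ logn p (geom_defect l.+1 l.+1) = (2 * logn p l)%N.
Proof.
move=> p_gt3; have [r E] := geom_defect_mod_cube l.
have p6 : ~~ (p %| 6)%N by rewrite (Euclid_dvdM 2 3) // negb_or !pNdvd.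
apply: (logn_of_int_eq (c := 6) l_gt0 p6 _ E).
by apply: pNdvdz; rewrite ?dvdz_mulr // dvdz_nat pNdvd.
Qed.

Lemma geom_exp_pred s : (l.+1 * (l.+1 ^ s).-1 = l * geom l.+1 s)%N.
Proof.
elim: s => [|s IH]; first by rewrite expn0 /geom big_ord0 !muln0.
rewrite geomSr mulnDr -IH.
have : (0 < l.+1 ^ s)%N by rewrite expn_gt0.
rewrite expnS; case: (l.+1 ^ s)%N => // x _; nia.
Qed.

Lemma logn_exp_pred s : (0 < s)%N ->
  logn p (l.+1 ^ s).-1 = (logn p l + logn p (geom l.+1 s))%N.
Proof.
move=> s_gt0; have g_gt0 : (0 < geom l.+1 s)%N.
  by case: s s_gt0 => // s _; rewrite geomS muln_gt0.
have := congr1 (logn p) (geom_exp_pred s).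
rewrite !lognM //; last by rewrite -subn1 subn_gt0 -(exp1n s) ltn_exp2r.
by rewrite lognE -[l.+1]expn1 (negPf (pe 0)) !andbF.
Qed.

Lemma logn_exp_coprime s : (0 < s)%N -> ~~ (p %| s)%N ->
  logn p (l.+1 ^ s).-1 = logn p l.
Proof.
move=> s_gt0 ps; rewrite logn_exp_pred //; have [r E] := geom_mod_sqr l s.
have [|||_ ->] := @logn_of_int_eq 2 (geom l.+1 s) l 0
  (2 * s%:Z + l%:Z * (s%:Z * (s%:Z + 1) + l%:Z * r))%R l_gt0; last by rewrite addn0.
- exact: pNdvd.
- apply: pNdvdz; last by rewrite dvdz_mulr.
  by rewrite -PoszM dvdz_nat Euclid_dvdM // negb_or pNdvd.
by rewrite E; ring.
Qed.

Lemma logn_exp_prime : logn p (l.+1 ^ p).-1 = (logn p l).+1.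
Proof.
rewrite logn_exp_pred ?prime_gt0 //; have [r E] := geom_mod_sqr l p.
have [u lE] := dvdnP pl.
have [|||_ ->] := @logn_of_int_eq 2 (geom l.+1 p) p 1
  (2 + p%:Z * (u%:Z * (p%:Z + 1 + u%:Z * r)))%R (prime_gt0 p_pr).
- exact: pNdvd.
- by apply: pNdvdz; rewrite ?dvdz_mulr // dvdz_nat pNdvd.
- by rewrite E lE PoszM; ring.
by rewrite mul1n (logn_prime p p_pr) eqxx addn1.
Qed.
End PrimeValuation.

(** Lifting the exponent, by induction on the valuation of [s]: one factor [p] of [s] is absorbed by
    passing from [e] to [e ^ p], which raises the valuation of [e.-1] by one. *)
Lemma logn_exp_sub1 p e s : prime p -> odd p -> (1 < e)%N -> (p %| e.-1)%N ->
  (0 < s)%N ->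
  logn p (e ^ s).-1 = (logn p e.-1 + logn p s)%N.
Proof.
move=> p_pr p_odd; have [j] := ubnP (logn p s).
elim: j e s => // j IH e s lt_j e_gt1 pe s_gt0.
have eE : e = e.-1.+1 by rewrite prednK // ltnW.
have e'_gt0 : (0 < e.-1)%N by rewrite -ltnS -eE.
have [/dvdnP[s' sE]|ps] := boolP (p %| s)%N; last first.
  rewrite {1}eE (logn_exp_coprime p_pr) //.
  by rewrite (lognE p s) (negPf ps) !andbF addn0.
have s'_gt0 : (0 < s')%N by case: s' sE s_gt0 => // ->.
have lsE : logn p s = (logn p s').+1.
  by rewrite sE (lognM p s'_gt0 (prime_gt0 p_pr)) (logn_prime p p_pr) eqxx addn1.
have lp : logn p (e ^ p).-1 = (logn p e.-1).+1 by rewrite {1}eE (logn_exp_prime p_pr).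
have ep_gt1 : (1 < e ^ p)%N by rewrite -(exp1n p) ltn_exp2r // prime_gt0.
rewrite lsE in lt_j; rewrite lsE sE mulnC expnM IH ?lp ?addnS //.
by move: lp; rewrite lognE; case: and3P => // -[].
Qed.

(** * The relations of the Heisenberg group in W and in J / Z_3(J) *)

Section PowersInPGroups.
Variables (gT : finGroupType) (p : nat).
Implicit Types (x y z c : gT) (K : {group gT}).

(** The prime-to-[p] part of [n] acts invertibly on a [p]-element, so both powers generate the same
    cyclic group. *)
Lemma mem_expg_logn x n K : p.-elt x -> (0 < n)%N -> x ^+ n \in K ->
  x ^+ (p ^ logn p n)%N \in K.
Proof.
move=> px n_gt0 xnK.
have nE : n = (p ^ logn p n * n`_p^')%N by rewrite -p_part partnC.
have : generator <[x ^+ (p ^ logn p n)%N]> (x ^+ (p ^ logn p n)%N ^+ n`_p^').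
  rewrite generator_coprime; apply: (@pnat_coprime p); last exact: part_pnat.
  exact: p_eltX.
move/eqP=> genE; have : x ^+ (p ^ logn p n)%N \in <[x ^+ (p ^ logn p n)%N]> by apply:
  cycle_id.
rewrite genE -expgM -nE; apply/subsetP; by rewrite cycle_subG.
Qed.

Lemma cycle_norm x z f : z * x * z^-1 = x ^+ f -> z \in 'N(<[x]>).
Proof.
move=> zx; rewrite -groupV inE -cycleJ conjgE invgK mulgA zx cycle_subG.
exact: mem_cycle.
Qed.

Lemma cycle_normV x z f : x ^ z = x ^+ f -> z \in 'N(<[x]>).
Proof. by move=> zx; rewrite inE -cycleJ zx cycle_subG mem_cycle. Qed.

(** By [pow_defect], conjugation by [z * [~ x, y] ^+ f] carries $y^D$ to $x^{-D}$; this element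
    normalizes both [<[x]>] and [<[y]>]. *)
Lemma mem_cycle_defect x y z e f : (0 < e)%N ->
  x ^ [~ x, y] = x ^+ e -> [~ x, y] * y * [~ x, y]^-1 = y ^+ e ->
  x ^ z = x ^+ f -> z * y * z^-1 = y ^+ f -> commute z [~ x, y] ->
  x ^+ geom_defect e f \in <[y]> /\ y ^+ geom_defect e f \in <[x]>.
Proof.
move=> e_gt0 xc yc xz yz zc; have E := pow_defect e_gt0 xc yc xz yz zc.
have nx : z * [~ x, y] ^+ f \in 'N(<[x]>).
  by rewrite groupM ?groupX // (cycle_normV xz, cycle_normV xc).
have ny : z * [~ x, y] ^+ f \in 'N(<[y]>).
  by rewrite groupM ?groupX // (cycle_norm yz, cycle_norm yc).
split; first by rewrite -groupV -E memJ_norm // mem_cycle.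
by rewrite -(memJ_norm _ nx) E groupV mem_cycle.
Qed.

End PowersInPGroups.

Section Wamsley.
Variables (gT : finGroupType) (p l f : nat) (x y z : gT).
Hypotheses (p_pr : prime p) (p_odd : odd p) (l_gt0 : (0 < l)%N) (pl : (p %| l)%N).
Hypotheses (pf : ~~ (p %| f * f.-1)%N) (pf1 : ~~ (p %| f.+1)%N).
Hypotheses (px : p.-elt x) (py : p.-elt y).
Local Notation c := [~ x, y].
Local Notation M := (p ^ logn p l)%N.
Hypotheses (xc : x ^ c = x ^+ l.+1) (yc : c * y * c^-1 = y ^+ l.+1).
Hypotheses (xz : x ^ z = x ^+ f) (yz : z * y * z^-1 = y ^+ f) (zc : commute z c).

Let f_gt0 : (0 < f)%N. Proof. by rewrite lt0n; apply: contraNneq pf => ->;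
  rewrite dvdn0. Qed.

Let pf2 : ~~ (p %| (f ^ 2).-1)%N.
Proof.
rewrite -subn1 -(exp1n 2) subn_sqr subn1 addn1.
by move: pf; rewrite !Euclid_dvdM // !negb_or pf1 => /andP[_ ->].
Qed.

Let M_dvd : (M %| l)%N. Proof. exact: pfactor_dvdnn. Qed.

(* [v] lies in [<[x]>] and in [<[y]>]; conjugation by [z] raises [x] to the
   power [f] and [y] to the power [1 / f], so [v ^+ (f ^ 2 - 1) = 1]. *)
Let cap_trivial i j : x ^+ i = y ^+ j -> x ^+ i = 1.
Proof.
move=> E.
have Ez : (x ^+ i) ^ z = (x ^+ i) ^+ f by rewrite conjXg xz -!expgM mulnC.
have Ez' : (x ^+ i) ^ z^-1 = (x ^+ i) ^+ f.
  by rewrite E conjXg conjgE invgK mulgA yz -!expgM mulnC.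
have E2 : (x ^+ i) ^+ (f ^ 2).-1 = 1.
  apply: (mulgI (x ^+ i)); rewrite mulg1 -expgS prednK ?expn_gt0 ?f_gt0 //.
  by rewrite -mulnn expgM -Ez' -conjXg -Ez conjgK.
apply/eqP; rewrite -order_eq1 -dvdn1; have := order_dvdn (x ^+ i) (f ^ 2).-1.
rewrite E2 eqxx => od.
have cop : coprime #[x ^+ i] (f ^ 2).-1.
  apply: (@pnat_coprime p); first exact: p_eltX.
  by rewrite p'natE.
by rewrite dvdn1 -(gcdn_idPl od).
Qed.

Let D := geom_defect l.+1 f.

Let D_gt0 : (0 < D)%N /\ logn p D = logn p l.
Proof. exact: logn_geom_defect. Qed.

Lemma wamsley_Heis_rel : Heis_rel M [:: x; y; c].
Proof.
have [D0 lD] := D_gt0.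
have [xD yD] := mem_cycle_defect (ltn0Sn l) xc yc xz yz zc.
have xM : x ^+ M = 1.
  apply/set1gP; rewrite -lD; apply: (@mem_expg_logn _ _ _ _ 1%G) => //.
  by case/cycleP: xD => j xDj; apply/set1gP/(cap_trivial xDj).
have yM : y ^+ M = 1.
  apply/set1gP; rewrite -lD; apply: (@mem_expg_logn _ _ _ _ 1%G) => //.
  by case/cycleP: yD => j yDj; apply/set1gP; rewrite yDj (cap_trivial (esym yDj)).
have lX (w : gT) : w ^+ M = 1 -> w ^+ l.+1 = w.
  by move=> wM; rewrite expgSr -(divnK M_dvd) mulnC expgM wM expg1n mul1g.
have xc1 : x ^ c = x by rewrite xc lX.
have yc1 : y ^ c = y.
  by apply/conjg_fixP/commgP/(mulIg c^-1); rewrite mulgK yc lX.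
split=> //; split=> //.
have cxc : commute x c by apply/commgP/conjg_fixP.
by rewrite -commXg // xM comm1g.
Qed.
End Wamsley.

Section UpperCentral.
Variables (gT : finGroupType) (J : {group gT}) (a b : gT).
Hypothesis genJ : <<[set a; b]>> = J.

Let aJ : a \in J. Proof. by rewrite -genJ mem_gen // !inE eqxx. Qed.
Let bJ : b \in J. Proof. by rewrite -genJ mem_gen // !inE eqxx orbT. Qed.

(** The elements commuting with [x] modulo ['Z_n(J)] form a subgroup, so two generators suffice. *)
Lemma ucnS_gen n x : x \in J -> [~ x, a] \in 'Z_n(J) -> [~ x, b] \in 'Z_n(J) ->
  x \in 'Z_n.+1(J).
Proof.
move=> xJ xa xb.
have nZ : J \subset 'N('Z_n(J)) by rewrite normal_norm ?ucn_normal.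
have xN := subsetP nZ x xJ; have aN := subsetP nZ a aJ; have bN := subsetP nZ b bJ.
have cZ y : y \in 'N('Z_n(J)) -> [~ x, y] \in 'Z_n(J) ->
    y \in coset 'Z_n(J) @*^-1 'C[coset 'Z_n(J) x].
  move=> yN xy; apply: mem_morphpre => //; rewrite cent1C; apply/cent1P/commgP.
  by rewrite -morphR //= coset_id.
have sJ : J \subset coset 'Z_n(J) @*^-1 'C[coset 'Z_n(J) x].
  suff: <<[set a; b]>> \subset coset 'Z_n(J) @*^-1 'C[coset 'Z_n(J) x] by rewrite genJ.
  by rewrite gen_subG; apply/subsetP=> y /set2P[]->; apply: cZ.
rewrite ucnSnR inE xJ /= gen_subG; apply/subsetP=> _ /imset2P[_ y /set1P-> yJ ->].
have /morphpreP[yN] := subsetP sJ y yJ.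
rewrite cent1C => /cent1P/commgP; rewrite -morphR //=.
by move/eqP/coset_idr; apply; rewrite groupR.
Qed.

Lemma ucnS_comm n x y : x \in 'Z_n.+1(J) -> y \in J -> [~ x, y] \in 'Z_n(J).
Proof.
rewrite ucnSnR inE => /andP[xJ /subsetP sZ] yJ; apply: sZ.
by rewrite mem_commg ?set11.
Qed.
End UpperCentral.

(** Used to see that [[~ a ^+ M, b]] is a conjugate of [c ^+ M] times a power of [a] with exponent
    divisible by [M ^ 2]. As [M] is odd, the factor 2 of [geom_mod_sqr] can be cancelled. *)
Lemma geom_pfactor p l (M := (p ^ logn p l)%N) :
  prime p -> odd p -> (0 < l)%N -> exists t, geom l.+1 M = (M + M ^ 2 * t)%N.
Proof.
move=> p_pr p_odd l_gt0.
have Ml : (M %| l)%N by apply: pfactor_dvdnn.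
have coM : coprime (M ^ 2) 2 by rewrite !coprimeXl // coprimen2.
clearbody M; have [r E] := geom_mod_sqr l M; have [u lE] := dvdnP Ml.
have le_M : (M <= geom l.+1 M)%N.
  rewrite /geom -[leqLHS]card_ord -sum1_card; apply: leq_sum => i _.
  by rewrite expn_gt0.
suff /dvdnP[t tE] : (M ^ 2 %| geom l.+1 M - M)%N.
  by exists t; rewrite mulnC -tE subnKC.
rewrite -(Gauss_dvdr _ coM).
suff : ((M ^ 2)%N %| (2 * (geom l.+1 M - M))%N%:Z)%Z by [].
apply/dvdzP; exists ((M%:Z + 1) * u%:Z + u%:Z ^+ 2 * r)%R.
by rewrite PoszM -subzn // mulrBr E lE -mulnn !PoszM; ring.
Qed.

Section Macdonald.
Variables (gT : finGroupType) (J : {group gT}) (p l : nat).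
Hypotheses (p_pr : prime p) (p_odd : odd p) (p_gt3 : (3 < p)%N).
Hypotheses (l_gt0 : (0 < l)%N) (pl : (p %| l)%N) (pJ : p.-group J).
Local Notation M := (p ^ logn p l)%N.
Local Notation e := l.+1.

Let M_dvd : (M %| l)%N. Proof. exact: pfactor_dvdnn. Qed.
Let M_gt0 : (0 < M)%N. Proof. by rewrite expn_gt0 prime_gt0. Qed.
Let lognM' : logn p M = logn p l. Proof. by rewrite pfactorK. Qed.

Let expM_dvd : (M ^ 2 %| (e ^ M).-1)%N.
Proof.
have eM : (0 < (e ^ M).-1)%N by rewrite -subn1 subn_gt0 -(exp1n M) ltn_exp2r.
by rewrite -expnM pfactor_dvdn // logn_exp_sub1 // lognM' mulnC mul2n addnn.
Qed.

Section Generators.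
Variables a b : gT.
Hypothesis genJ : <<[set a; b]>> = J.
Local Notation c := [~ a, b].
Hypotheses (ac : a ^ c = a ^+ e) (bc : c * b * c^-1 = b ^+ e).

Let aJ : a \in J. Proof. by rewrite -genJ mem_gen // !inE eqxx. Qed.
Let bJ : b \in J. Proof. by rewrite -genJ mem_gen // !inE eqxx orbT. Qed.
Let cJ : c \in J. Proof. by rewrite groupR. Qed.

Let nZ n x : x \in J -> x \in 'N('Z_n(J)).
Proof. by apply: subsetP; rewrite normal_norm ?ucn_normal. Qed.

Lemma expg_sqr_Z1 k : (M ^ 2 %| k)%N -> a ^+ k \in 'Z_1(J).
Proof.
case/dvdnP=> t ->; rewrite mulnC expgM; apply: groupX.
have [aD _] := mem_cycle_defect (ltn0Sn l) ac bc ac bc (commute_refl c).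
have [D_gt0 lD] := logn_geom_defect_diag p_pr l_gt0 p_odd pl p_gt3.
have ab : a ^+ (M ^ 2) \in <[b]>.
  have := mem_expg_logn (mem_p_elt pJ aJ) D_gt0 aD.
  by rewrite lD mulnC expnM.
apply: (ucnS_gen genJ); rewrite ?groupX // ucn0 inE.
  by apply/commgP/commute_sym/commuteX.
by case/cycleP: ab => j ->; apply/commgP/commute_sym/commuteX.
Qed.

(** Up to inversion and conjugation by a power of [c], the commutators of [c ^+ M] with [a] and [b]
    are their powers with exponent [(e ^ M).-1], a multiple of [M ^ 2]. *)
Lemma commg_expg_Z2 (b_Z1 : forall k, (M ^ 2 %| k)%N ->
  b ^+ k \in 'Z_1(J)) : c ^+ M \in 'Z_2(J).
Proof.
have eM (w : gT) : w * w ^+ (e ^ M).-1 = w ^+ (e ^ M) by rewrite -expgS prednK //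
  expn_gt0.
apply: (ucnS_gen genJ); rewrite ?groupX //.
  rewrite -groupV invgR commgEl -[a in a ^ _]expg1 (conj_pow _ _ ac) mul1n -eM mulKg.
  exact: expg_sqr_Z1.
have bc' : b ^ c^-1 = b ^+ e by rewrite conjgE invgK mulgA.
rewrite -(memJ_norm _ (nZ 1 (groupVr (groupX M cJ)))) commgEr conjMg.
rewrite -conjgM mulgV conjg1 -expVgn -[b in b ^ _]expg1 (conj_pow _ _ bc') mul1n.
by rewrite -eM mulKg; apply: b_Z1.
Qed.

Lemma expg_Z3 (b_Z1 : forall k, (M ^ 2 %| k)%N ->
  b ^+ k \in 'Z_1(J)) : a ^+ M \in 'Z_3(J).
Proof.
apply: (ucnS_gen genJ); rewrite ?groupX //.
  by rewrite (_ : [~ _, _] = 1) ?group1 //; apply/eqP/commgP/commute_sym/commuteX.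
have [t tE] := geom_pfactor p_pr p_odd l_gt0.
rewrite commgEl (pow_conj _ ac) tE expgD !mulgA -(mulgA _ (c ^+ M)) -conjgE.
apply: groupM; first by rewrite memJ_norm ?commg_expg_Z2 // nZ ?groupX.
by apply: (subsetP (ucn_subS 1 J)); apply: expg_sqr_Z1; rewrite dvdn_mulr.
Qed.

(* The commutators of [c ^+ t] with [a], [b], [a] are, up to central factors,
   [a ^- (e ^ t).-1], [c ^+ (e ^ t).-1] and a power of [a] whose exponent has
   valuation [2 m + v t]. *)
Lemma dvdn_commg_Z3 t : (forall n, a ^+ n = 1 -> (M ^ 3 %| n)%N) ->
  c ^+ t \in 'Z_3(J) -> (M %| t)%N.
Proof.
move=> a_order; case: (posnP t) => [-> | t_gt0 ct]; first by rewrite dvdn0.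
have eS k : (0 < k)%N -> (0 < (e ^ k).-1)%N.
  by move=> k_gt0; rewrite -subn1 subn_gt0 -(exp1n k) ltn_exp2r.
have eM (w : gT) k : w * w ^+ (e ^ k).-1 = w ^+ (e ^ k).
  by rewrite -expgS prednK // expn_gt0.
have as2 : a ^+ (e ^ t).-1 \in 'Z_2(J).
  have := ucnS_comm ct aJ; rewrite -groupV invgR commgEl -[a in a ^ _]expg1.
  by rewrite (conj_pow _ _ ac) mul1n -eM mulKg.
set s := (e ^ t).-1 in as2; have s_gt0 : (0 < s)%N by apply: eS.
have /commgP cas : [~ [~ a ^+ s, b], a] == 1.
  by have := ucnS_comm (ucnS_comm as2 bJ) aJ; rewrite ucn0 inE.
have ca : commute (c ^+ s) a.
  have -> : c ^+ s = a ^+ s * [~ a ^+ s, b] * a ^- geom e s.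
    by rewrite commgEl mulKVg (pow_conj _ ac) mulgK.
  apply/commute_sym/commuteM; last exact/commuteV/commuteX.
  by apply: commuteM; [apply: commuteX | apply: commute_sym].
have aes : a ^+ (e ^ s).-1 = 1.
  apply: (mulgI a); rewrite eM mulg1 -[in LHS](mul1n (e ^ s)%N) -(conj_pow _ _ ac).
  by rewrite expg1 conjgE -ca mulKg.
have := a_order _ aes; rewrite -expnM pfactor_dvdn ?eS // logn_exp_sub1 //.
rewrite logn_exp_sub1 // pfactor_dvdn // /=; lia.
Qed.
End Generators.

Variables a b : gT.
Hypothesis genJ : <<[set a; b]>> = J.
Local Notation c := [~ a, b].
Hypotheses (ac : a ^ c = a ^+ e) (bc : c * b * c^-1 = b ^+ e).

Lemma macdonald_Heis_rel :
  Heis_rel M [:: coset 'Z_3(J) a; coset 'Z_3(J) b; coset 'Z_3(J) c].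
Proof.
have aJ : a \in J by rewrite -genJ mem_gen // !inE eqxx.
have bJ : b \in J by rewrite -genJ mem_gen // !inE eqxx orbT.
have cJ : c \in J by rewrite groupR.
have nZ : J \subset 'N('Z_3(J)) by rewrite normal_norm ?ucn_normal.
have aN := subsetP nZ a aJ; have bN := subsetP nZ b bJ; have cN := subsetP nZ c cJ.
(* Exchanging [a] and [b] inverts [c] and swaps the two relations, so the results on [a] apply to
   [b]. *)
have genJ' : <<[set b; a]>> = J by rewrite setUC.
have bc' : b ^ [~ b, a] = b ^+ e by rewrite -invgR conjgE invgK mulgA.
have ac' : [~ b, a] * a * [~ b, a]^-1 = a ^+ e by rewrite -ac -(invgR b a)
  conjgE invgK -mulgA.
have aZ1 := expg_sqr_Z1 genJ ac bc; have bZ1 := expg_sqr_Z1 genJ' bc' ac'.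
have aM : coset 'Z_3(J) a ^+ M = 1.
  by rewrite -morphX //= coset_id // (expg_Z3 genJ).
have bM : coset 'Z_3(J) b ^+ M = 1.
  by rewrite -morphX //= coset_id // (expg_Z3 genJ').
have lX (w : coset_of 'Z_3(J)) : w ^+ M = 1 -> w ^+ e = w.
  by move=> wM; rewrite expgSr -(divnK M_dvd) mulnC expgM wM expg1n mul1g.
split; rewrite ?morphR //=.
- by rewrite -[in LHS]morphR //= -morphJ //= ac morphX //= lX.
- rewrite -morphR //=; apply/conjg_fixP/commgP/(mulIg (coset 'Z_3(J) c)^-1).
  by rewrite mulgK -[in RHS]morphV //= -!morphM ?groupM ?groupV //= bc morphX //= lX.
split=> //; rewrite -morphR //= -morphX //= coset_id //.
apply: (subsetP (ucn_subS 2 J)); exact: (commg_expg_Z2 genJ).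
Qed.
End Macdonald.

(** If the word is trivial, [b ^+ j] is a product of powers of [a] and [c] and so commutes with [a];
    then [c ^+ j = [~ a, b ^+ j] = 1], and likewise [c ^+ i = 1]. Thus the order of [c] controls all
    three exponents. *)
Lemma Heis_rel_trivial_word (hT : finGroupType) (M : nat) (a b c : hT) i j k :
  (0 < M)%N -> Heis_rel M [:: a; b; c] -> (forall t, c ^+ t = 1 -> (M %| t)%N) ->
  a ^+ i * b ^+ j * c ^+ k = 1 -> [/\ M %| i, M %| j & M %| k]%N.
Proof.
move=> M_gt0 [cE ac bc [aM bM cM]] c_order abc.
have cac : commute a c by apply/commgP/conjg_fixP.
have cbc : commute b c by apply/commgP/conjg_fixP.
have /c_order Mj : c ^+ j = 1.
  rewrite cE -commgX -?cE //; apply/eqP/commgP.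
  have -> : b ^+ j = a ^- i * c ^- k by apply/(mulgI (a ^+ i))/(mulIg (c ^+ k));
    rewrite abc mulKVg mulVg.
  by apply: commuteM; [apply/commuteV/commuteX | apply/commuteV/commuteX].
have /c_order Mi : c ^+ i = 1.
  rewrite cE -commXg -?cE //; apply/eqP/commgP/commute_sym.
  have -> : a ^+ i = c ^- k * b ^- j.
    by apply: (mulIg (b ^+ j * c ^+ k)); rewrite mulgA abc -mulgA mulKg mulVg.
  by apply: commuteM; [apply/commuteV/commuteX | apply/commuteV/commuteX].
have xM (x : hT) n : x ^+ M = 1 -> (M %| n)%N -> x ^+ n = 1.
  by move=> x1 /dvdnP[t ->]; rewrite mulnC expgM x1 expg1n.
by split=> //; apply: c_order; move: abc; rewrite (xM a) // (xM b) // !mul1g.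
Qed.

(** * Heisenberg groups and presentations *)

Lemma mem_seq_gen (gT : finGroupType) (s : seq gT) x : x \in s ->
  x \in <<[set y in s]>>.
Proof. by move=> xs; rewrite mem_gen ?inE. Qed.

Section HeisenbergMatrices.
Variable R : finComUnitRingType.
Local Open Scope ring_scope.
Implicit Types x y z : R.

Definition heis_mx x y z : 'M[R]_3 :=
  1%:M + x *: delta_mx 0 1 + y *: delta_mx 1 2%:R + z *: delta_mx 0 2%:R.

Lemma heis_mxM x y z x' y' z' :
  heis_mx x y z * heis_mx x' y' z' = heis_mx (x + x') (y + y') (z + z' + x * y').
Proof.
rewrite /heis_mx -[_ * _]/(_ *m _) !mulmxDl !mulmxDr.
rewrite -!scalemxAl -!scalemxAr.
rewrite !(mul_delta_mx, mul_delta_mx_0) //.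
rewrite !mul1mx !mulmx1 !scaler0 !addr0.
by apply/matrixP=> i j; rewrite !mxE; ring.
Qed.

Lemma heis_mx0 : heis_mx 0 0 0 = 1.
Proof. by rewrite /heis_mx !scale0r !addr0. Qed.

Lemma heis_mx_unit x y z : heis_mx x y z \is a GRing.unit.
Proof.
have : heis_mx x y z *m heis_mx (- x) (- y) (x * y - z) = 1%:M.
  rewrite -[_ *m _]/(_ * _) heis_mxM !subrr mulrN.
  have -> : z + (x * y - z) - x * y = 0 by ring.
  exact: heis_mx0.
by case/mulmx1_unit.
Qed.

Definition heis x y z : {'GL_3[R]} := FinRing.Unit (heis_mx_unit x y z).

Lemma heis_coef x y z :
  [/\ heis_mx x y z 0 1 = x, heis_mx x y z 1 2%:R = y & heis_mx x y z 0 2%:R = z].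
Proof. by split; rewrite !mxE /=; ring. Qed.

Lemma heis_inj x y z x' y' z' : heis x y z = heis x' y' z' ->
  [/\ x = x', y = y' & z = z'].
Proof.
move/(congr1 (@GLval 3 R)) => E.
have {}E : heis_mx x y z = heis_mx x' y' z' by [].
have [Ex Ey Ez] := heis_coef x y z; have [Ex' Ey' Ez'] := heis_coef x' y' z'.
by split; [rewrite -[LHS]Ex -[RHS]Ex' | rewrite -[LHS]Ey -[RHS]Ey'
  | rewrite -[LHS]Ez -[RHS]Ez']; rewrite E.
Qed.

Lemma heisM x y z x' y' z' :
  (heis x y z * heis x' y' z')%g = heis (x + x') (y + y') (z + z' + x * y').
Proof. by apply/val_inj/heis_mxM. Qed.

Lemma heis0 : heis 0 0 0 = 1%g.
Proof. by apply/val_inj/heis_mx0. Qed.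

Lemma mem_Heis (g : {'GL_3[R]}) : reflect (exists x y z, g = heis x y z) (g \in Heis R).
Proof.
rewrite inE; apply: (iffP idP) => [|[x [y [z ->]]]]; last first.
  apply/forallP=> i; apply/forallP=> j; apply/implyP=> le_ji.
  rewrite !mxE; case: i j le_ji => [[|[|[|//]]] ?] [[|[|[|//]]] ?] //= _;
    by rewrite !mulr0 !addr0.
move=> /forallP gP; exists (GLval g 0 1), (GLval g 1 2%:R), (GLval g 0 2%:R).
apply/val_inj/matrixP=> i j; have := forallP (gP i) j; rewrite !mxE /=.
case: i j => [[|[|[|//]]] i3] [[|[|[|//]]] j3] //= => [/eqP->|_|_|/eqP->|/eqP->|_|/eqP->|/eqP->|/eqP->];
  rewrite ?mulr0 ?mulr1 ?addr0 ?add0r //; congr (GLval g _ _); exact/val_inj.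
Qed.

Lemma card_Heis : #|Heis R| = (#|R| ^ 3)%N.
Proof.
have -> : Heis R = [set heis t.1.1 t.1.2 t.2 | t : R * R * R].
  apply/setP=> g; apply/mem_Heis/imsetP => [[x [y [z ->]]]|[[[x y] z] _ ->]].
    by exists (x, y, z).
  by exists x, y, z.
rewrite card_imset; first by rewrite !card_prod !expnS expn0 muln1 mulnA.
by move=> [[x y] z] [[x' y'] z'] /heis_inj[/= -> -> ->].
Qed.

Lemma heis_exp x y z n : x * y = 0 ->
  (heis x y z ^+ n)%g = heis (x *+ n) (y *+ n) (z *+ n).
Proof.
move=> xy; elim: n => [|n IH]; first by rewrite expg0 !mulr0n heis0.
by rewrite expgSr IH heisM !mulrSr mulrnAl xy mul0rn addr0.
Qed.

Local Notation heis_gens :=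
  [:: heis 1%R 0%R 0%R; heis 0%R 1%R 0%R; heis 0%R 0%R 1%R].

Lemma mem_gen_heis (i j k : nat) :
  heis i%:R j%:R k%:R \in <<[set g in heis_gens]>>%g.
Proof.
have [aG bG cG] : [/\ heis 1 0 0 \in <<[set g in heis_gens]>>%g,
  heis 0 1 0 \in <<[set g in heis_gens]>>%g &
    heis 0 0 1 \in <<[set g in heis_gens]>>%g].
  by split; apply: mem_seq_gen; rewrite !in_cons eqxx ?orbT.
pose a := heis 1 0 0; pose b := heis 0 1 0; pose c := heis 0 0 1.
(* With [b] on the left of [a], the cross term of [heisM] vanishes. *)
have -> : heis i%:R j%:R k%:R = (b ^+ j * a ^+ i * c ^+ k)%g.
  by rewrite !heis_exp ?mul0r ?mulr0 // !mul0rn !heisM; congr heis; ring.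
by rewrite !groupM ?groupX.
Qed.

Lemma Heis_rel_heis M : M%:R = 0 :> R ->
  Heis_rel M heis_gens.
Proof.
move=> M0; pose a := heis 1 0 0; pose b := heis 0 1 0.
have cE : heis 0 0 1 = [~ a, b]%g.
  by apply: (mulgI (b * a)%g); rewrite -commgC !heisM; congr heis; ring.
split=> //.
- by apply/conjg_fixP/commgP; rewrite /commute !heisM; congr heis; ring.
- by apply/conjg_fixP/commgP; rewrite /commute !heisM; congr heis; ring.
by split; rewrite heis_exp ?mul0r ?mulr0 // !(mul0rn, M0) ?heis0.
Qed.
End HeisenbergMatrices.

Lemma eq_morph_gen (gT rT : finGroupType) (A : {set gT}) (f g : gT -> rT) :
  {in <<A>> &, {morph f : x y / x * y}} -> {in <<A>> &, {morph g : x y / x * y}} ->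
  {in A, f =1 g} -> {in <<A>>, f =1 g}.
Proof.
move=> fM gM fg.
have m1 (h : gT -> rT) : {in <<A>> &, {morph h : x y / x * y}} -> h 1 = 1.
  by move=> hM; apply: (mulgI (h 1)); rewrite -hM ?group1 // !mulg1.
have gS : group_set [set x in <<A>> | f x == g x].
  apply/group_setP; split=> [|x y]; first by rewrite inE group1 !m1 /=.
  rewrite !inE => /andP[xA /eqP fx] /andP[yA /eqP fy].
  by rewrite groupM //= fM // gM // fx fy.
move=> x xA; have : <<A>> \subset Group gS.
  by rewrite gen_subG; apply/subsetP=> y yA; rewrite inE mem_gen //= fg.
by move=> /subsetP/(_ x xA); rewrite inE => /andP[_ /eqP].
Qed.

Lemma presented_morphism (gT hT : finGroupType) (K : {group gT}) s (R : relations) t :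
  presented K s R -> R hT t ->
  exists2 f : {morphism K >-> hT}, map f s = t & f @* K = <<[set x in t]>>.
Proof.
case=> genK _ UK Rt; have [f fM fs] := UK hT t Rt.
exists (Morphism fM) => //=.
have sK : [set x in s] \subset K by rewrite -genK subset_gen.
rewrite -{3}genK (morphim_gen (Morphism fM)) //; congr <<_>>.
apply/setP=> y; rewrite inE -fs; apply/morphimP/mapP => [[x _]|[x xs ->]].
  by rewrite inE => xs ->; exists x.
by exists x; rewrite ?inE // (subsetP sK) ?inE.
Qed.

(** A surjective endomorphism of a finite group is bijective. *)
Lemma presented_aut (gT : finGroupType) (K : {group gT}) s (R : relations) t :
  presented K s R -> R gT t -> <<[set x in t]>> = K ->
  exists2 sigma : {perm gT}, sigma \in Aut K & map sigma s = t.
Proof.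
move=> presK Rt genK; have [f fs fK] := presented_morphism presK Rt.
rewrite genK in fK.
have injf : 'injm f by rewrite -card_im_injm fK.
exists (aut injf fK); first exact: Aut_aut.
rewrite -fs; apply/eq_in_map => x xs; apply: autE.
by case: presK => <- _ _; rewrite mem_gen ?inE.
Qed.

Lemma Wp_rel_swap alpha M L q r (hT : groupType) (a b c d : hT) :
  Wp_rel alpha M L q r [:: a; b; c; d] ->
  Wp_rel alpha M L q r [:: b; a; c^-1; d^-1].
Proof.
have fixV (x y : hT) : x ^ y = x -> x ^ y^-1 = x.
  by move=> E; rewrite -{1}E conjgK.
case=> -[cE ac bc [aM bM cM]] [ad bd dL]; split; last first.
  split; last by rewrite !expVgn dL.
    by rewrite conjgE invgK mulgA.
  by rewrite invgK -mulgA.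
split=> //; first by rewrite cE invgR.
- exact: fixV.
- exact: fixV.
by rewrite expVgn cM invg1.
Qed.

(** The degenerate case [d = 1], [L = 1], through which the normal form of $W_p$ also serves the
    Heisenberg group. *)
Lemma Heis_Wp_rel M (hT : groupType) (a b c : hT) :
  Heis_rel M [:: a; b; c] <-> Wp_rel 1 M 1 0 0 [:: a; b; c; 1].
Proof.
split=> [H|[]//]; split=> //.
by split; rewrite /= ?conjg1 ?mul1g ?invg1 ?mulg1 ?expg1.
Qed.

Lemma isog_Heis (gT : finGroupType) (K : {group gT}) (M : nat) (a b c : gT) :
  (1 < M)%N -> presented K [:: a; b; c] (Heis_rel M) -> #|K| = (M ^ 3)%N ->
  K \isog Heis 'Z_M.
Proof.
move=> M_gt1 presK cardK.
pose a' := heis (1%R : 'Z_M) 0%R 0%R; pose b' := heis (0%R : 'Z_M) 1%R 0%R.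
pose c' := heis (0%R : 'Z_M) 0%R 1%R.
have relH : Heis_rel M [:: a'; b'; c'] by apply/Heis_rel_heis/pchar_Zp.
have [f _ fK] := presented_morphism presK relH.
have fKE : f @* K = Heis 'Z_M.
  rewrite fK; apply/eqP; rewrite eqEsubset; apply/andP; split.
    rewrite gen_subG; apply/subsetP=> g; rewrite 4!inE.
    by case/or3P=> /eqP ->; apply/mem_Heis; do 3!eexists.
  apply/subsetP=> _ /mem_Heis[x [y [z ->]]].
  by rewrite -[x]natr_Zp -[y]natr_Zp -[z]natr_Zp mem_gen_heis.
apply/isogP; exists f => //.
by rewrite -card_im_injm fKE card_Heis cardK card_ord Zp_cast.
Qed.

(** * Lower bounds on orders *)

Lemma int_nat_mod (z : int) (N : nat) : (0 < N)%N ->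
  exists n : nat, (z = n %[mod N])%Z.
Proof.
move=> N_gt0; exists `|(z %% N)%Z|%N.
by rewrite gez0_abs ?modz_ge0 -?lt0n ?modz_mod // -lt0n.
Qed.

Lemma expgz_card (gT : finGroupType) (x : gT) (z : int) (n N : nat) :
  (#|gT| %| N)%N -> (z = n %[mod N])%Z -> expgz x z = x ^+ n.
Proof.
move=> /dvdnP[k ->]; apply: expgz_nat.
by rewrite mulnC expgM -cardsT (expg_cardG (in_setT x)) expg1n.
Qed.

Section NilpotentProjection.
Variables (gT : finGroupType) (G : {group gT}) (p : nat).
Hypothesis nilG : nilpotent G.

Let complG : 'O_p^'(G)%G \in [complements to 'O_p(G) in G].
Proof.
have /dprodP[_ defG _ ti] := nilpotent_pcoreC p nilG.
by apply/complP; rewrite ti defG.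
Qed.

Lemma Sylow_projM : {in G &, {morph Sylow_proj p G : x y / x * y}}.
Proof.
apply: divgrM complG _.
by have /dprodP[] := nilpotent_pcoreC p nilG.
Qed.

Lemma Sylow_projE x : x \in G -> Sylow_proj p G x = x.`_p.
Proof.
move=> xG; have /dprodP[_ defG _ ti] := nilpotent_pcoreC p nilG.
have mem_core pi : x.`_pi \in 'O_pi(G).
  by rewrite (mem_Hall_pcore (nilpotent_pcore_Hall pi nilG)) ?p_elt_constt // groupX.
by rewrite /Sylow_proj -{1}(consttC p x) divgrMid.
Qed.

Lemma consttM_nil : {in G &, {morph (fun x => x.`_p) : x y / x * y}}.
Proof.
by move=> x y xG yG; rewrite -!Sylow_projE ?groupM // Sylow_projM.
Qed.
End NilpotentProjection.

Lemma dvdn_order_macdonald (alpha : int) (gamma p m : nat) (gT : finGroupType) (A B :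
  gT) n :
  prime p -> (3 < p)%N -> ((p ^ m)%N %| (alpha ^+ gamma - 1)%R)%Z -> (0 < m)%N ->
  presented [set: gT]%G [:: A; B] (G_rel alpha gamma) ->
  (A.`_p) ^+ n = 1 -> ((p ^ m) ^ 3 %| n)%N.
Proof.
move=> p_pr p_gt3 pe m_gt0 presG An1.
set M := (p ^ m)%N in pe *; pose N := (M ^ 3)%N.
have M_gt1 : (1 < M)%N by rewrite -(exp1n m) ltn_exp2r // prime_gt1.
have N_gt1 : (1 < N)%N by rewrite -(exp1n 3) ltn_exp2r.
have perm_gt0 : (0 < N * #|{perm 'Z_N * 'Z_N}|)%N.
  by rewrite muln_gt0 (ltnW N_gt1) -cardsT cardG_gt0.
(* The modulus contains the order of the symmetric group, where integer powers become natural ones,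
   and a multiple of [M], so that [M] still divides $e-1$. *)
have [e eE] := int_nat_mod (alpha ^+ gamma)%R perm_gt0.
have /dvdzP[k kE] : (M %| (e%:Z - 1)%R)%Z.
  have -> : (e%:Z - 1 = (alpha ^+ gamma - 1) - (alpha ^+ gamma - e%:Z))%R by ring.
  rewrite rpredB //; apply: dvdz_trans (_ : (N * #|{perm 'Z_N * 'Z_N}|)%N %| _)%Z.
    by rewrite dvdzE /= -mulnA dvdn_mulr // dvdn_mulr.
  by rewrite -eqz_mod_dvd; apply/eqP.
have u24 : (24%:R : 'Z_N)%R \is a GRing.unit.
  rewrite unitZpE // /N /M !coprimeXl // prime_coprime //.
  apply: contraL p_gt3 => p24; have : p \in primes 24 by rewrite mem_primes p_pr.
  by rewrite !inE => /orP[] /eqP->.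
pose L : 'Z_N := ((e%:R - 1) / 24%:R)%R.
have eR : (e%:R - 1 = k%:~R * M%:R :> 'Z_N)%R.
  have -> : (e%:R - 1 = (e%:Z - 1)%:~R :> 'Z_N)%R by rewrite rmorphB.
  by rewrite kE rmorphM.
have L3 : (L ^+ 3 = 0)%R.
  by rewrite /L eR !exprMn -natrX pchar_Zp // mulr0 mul0r.
have eL : (e%:R = 1 + 24 * L)%R.
  by rewrite mulrC divrK // addrC subrK.
have [a [b [ac bc a_order]]] := macdonald_model L3 eL.
have relG : G_rel alpha gamma [:: a; b].
  by split; rewrite (expgz_card _ _ eE) // dvdn_mull.
have [f [fA _] _] := presented_morphism presG relG.
have {}An1 : a.`_p ^+ n = 1 by rewrite -fA -morph_constt ?inE // -morphX ?inE //
  An1 morph1.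
(* The hypothesis concerns only the [p]-part of [a]. The extra factor kills the remaining part and
   is coprime to [p], so it cancels from the divisibility. *)
have /a_order : a ^+ (n * #[a.`_p^'])%N = 1.
  rewrite -{1}(consttC p a) expgMn; last exact: (commuteX2 _ _ (commute_refl a)).
  by rewrite expgM An1 expg1n mul1g mulnC expgM expg_order expg1n.
move/(congr1 val); rewrite /= val_Zp_nat // => /eqP; rewrite -/(dvdn _ _).
rewrite Gauss_dvdl // /N; apply: (@pnat_coprime p); first by rewrite !pnatX pnat_id.
exact: p_elt_constt.
Qed.

Lemma card_wamsley (alpha : int) (gamma M : nat) (wT : finGroupType) (X Y Z : wT) :
  (0 < gamma)%N -> (1 < M)%N -> (M %| (alpha ^+ gamma - 1)%R)%Z ->
  presented [set: wT]%G [:: X; Y; Z] (W_rel alpha gamma) ->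
  (M * M * (gamma * M) %| #|wT|)%N.
Proof.
move=> gamma_gt0 M_gt1 Ma presW.
pose T : finType := {perm 'Z_M * 'Z_M * 'Z_(gamma * M)}.
have perm_gt0 : (0 < M * #|T|)%N by rewrite muln_gt0 (ltnW M_gt1) -cardsT cardG_gt0.
have [f fE] := int_nat_mod alpha perm_gt0.
have fX : (f ^ gamma = 1 %[mod M])%N.
  have fM : (f = alpha %[mod M])%Z.
    apply/eqP; rewrite eqz_mod_dvd; apply: dvdz_trans (_ : (M * #|T|)%N %| _)%Z.
      by rewrite dvdzE /= dvdn_mulr.
    by rewrite -eqz_mod_dvd eq_sym; apply/eqP.
  have : (Posz (f ^ gamma) = 1 %[mod M])%Z.
    rewrite -natz natrX natz -modzXm fM modzXm.
    by apply/eqP; rewrite eqz_mod_dvd.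
  by rewrite !modz_nat => -[].
have [x [y [z [xz yz xy dM]]]] := wamsley_model M_gt1 gamma_gt0 fX.
have relW : W_rel alpha gamma [:: x; y; z].
  by split; rewrite ?(expgz_card _ _ fE) // dvdn_mull.
have [h _ hW] := presented_morphism presW relW.
apply: dvdn_trans dM _.
have -> : <<[set x; y; z]>> = h @* [set: wT].
  rewrite hW; congr <<_>>; by apply/setP=> u; rewrite !inE -!orbA.
by rewrite -cardsT dvdn_morphim.
Qed.

(** * Sylow subgroups and automorphisms *)

Section HeisPresentation.
Variables (gT : finGroupType) (K : {group gT}) (M : nat) (a b c : gT).
Hypotheses (M_gt0 : (0 < M)%N) (relK : Heis_rel M [:: a; b; c]).
Hypothesis genK : <<[set x in [:: a; b; c]]>> = K.

Let genK1 : <<[set x in [:: a; b; c; 1]]>> = K.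
Proof.
rewrite -genK; apply/eqP; rewrite eqEsubset !gen_subG; apply/andP; split.
  apply/subsetP=> x; rewrite inE => xs.
  have [-> //|x1] := eqVneq x 1; rewrite mem_gen // inE.
  by move: xs; rewrite !inE (negPf x1) orbF.
apply/subsetP=> x; rewrite inE => xs; rewrite mem_gen // inE.
by move: xs; rewrite !inE => /or3P[] ->; rewrite ?orbT.
Qed.

Let rel1 : ((1 ^+ 0)%R = 1%N %[mod M])%Z. Proof. by []. Qed.
Let rel1W := (Heis_Wp_rel M a b c).1 relK.

Lemma Heis_word_ex x : x \in K -> exists i j k, x = a ^+ i * b ^+ j * c ^+ k.
Proof.
have := normal_of_surj M_gt0 (ltn0Sn 0) rel1 (erefl : (1 * 1 = 1 %[mod M])%N)
  genK1 rel1W.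
move=> /subsetP sS /sS/imsetP[[[[i j] k] l] _ ->]; exists i, j, k.
by rewrite /= /normal_word expg1n mulg1.
Qed.

Lemma card_Heis_le : (#|K| <= M ^ 3)%N.
Proof.
have := card_normal_le M_gt0 (ltn0Sn 0) rel1 (erefl : (1 * 1 = 1 %[mod M])%N)
  genK1 rel1W.
by rewrite muln1.
Qed.

Lemma presented_Heis : (M ^ 3 <= #|K|)%N -> presented K [:: a; b; c] (Heis_rel M).
Proof.
move=> cardK.
have [_ _ UK] := presented_normal M_gt0 (ltn0Sn 0) rel1 (erefl : (1 * 1 = 1 %[mod M])%N)
  genK1 rel1W (etrans (congr1 (leq^~ _) (muln1 _)) cardK).
split=> // hT [|a' [|b' [|c' [|? ?]]]] // /Heis_Wp_rel relT.
by have [f fM [fa fb fc _]] := UK hT _ relT; exists f; rewrite //= fa fb fc.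
Qed.
End HeisPresentation.

(** The presentation of [J / N] factors the projection onto [J / 'Z_3(J)] through it, so [N] lies in
    ['Z_3(J)]. Conversely, an element of ['Z_3(J)] is modulo [N] a word in the generators; the word
    is trivial modulo ['Z_3(J)], so [M] divides its exponents. *)
Lemma eq_Z3_of_presented (gT : finGroupType) (J N : {group gT}) (a b c : gT) (M : nat) :
  (0 < M)%N -> N <| J -> <<[set a; b]>> = J -> c \in J ->
  presented (J / N)%G [:: coset N a; coset N b; coset N c] (Heis_rel M) ->
  Heis_rel M [:: coset 'Z_3(J) a; coset 'Z_3(J) b; coset 'Z_3(J) c] ->
  (forall t, c ^+ t \in 'Z_3(J) -> (M %| t)%N) ->
  N :=: 'Z_3(J).
Proof.
move=> M_gt0 nNJ genJ cJ presN relZ c_order.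
have aJ : a \in J by rewrite -genJ mem_gen // !inE eqxx.
have bJ : b \in J by rewrite -genJ mem_gen // !inE eqxx orbT.
have nN x : x \in J -> x \in 'N(N) by apply/subsetP/normal_norm.
have nZ x : x \in J -> x \in 'N('Z_3(J)) by apply/subsetP/normal_norm/ucn_normal.
have [f [fa fb fc] _] := presented_morphism presN relZ.
have fE : {in J, forall x, f (coset N x) = coset 'Z_3(J) x}.
  have E := @eq_morph_gen _ _ [set a; b] (fun x => f (coset N x)) (coset 'Z_3(J)).
  rewrite genJ in E; apply: E => [x y xJ yJ|x y xJ yJ|x /set2P[] -> //].
    by rewrite (morphM (coset_morphism N)) ?nN // morphM ?mem_quotient.
  by rewrite (morphM (coset_morphism 'Z_3(J))) ?nZ.
apply/eqP; rewrite eqEsubset; apply/andP; split; apply/subsetP=> x xN.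
  have xJ := subsetP (normal_sub nNJ) x xN.
  by apply: coset_idr; rewrite ?nZ // -fE // coset_id // morph1.
have xJ := subsetP (ucn_sub 3 J) x xN.
have [genN relN _] := presN.
have [i [j [k xE]]] := Heis_word_ex M_gt0 relN genN (mem_quotient N xJ).
have [aN bN cN] : [/\ coset N a \in J / N, coset N b \in J / N & coset N c \in J / N].
  by split; apply: mem_quotient.
have := fE x xJ; rewrite xE [RHS]coset_id //.
rewrite !morphM ?groupM ?groupX // !morphX // fa fb fc.
case/(Heis_rel_trivial_word M_gt0 relZ) => [t|/dvdnP[u Ei] /dvdnP[v Ej] /dvdnP[w Ek]].
  rewrite -morphX ?nZ //= => /(coset_idr (nZ _ (groupX t cJ))).
  exact: c_order.
apply: coset_idr; rewrite ?nN // xE Ei Ej Ek.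
case: relN => _ _ _ [aM bM cM].
by rewrite !(mulnC _ M) !expgM aM bM cM !expg1n !mulg1.
Qed.

(** [P <*> <[d]>] is a Sylow subgroup by its order. An element conjugating it to [S] is a product
    from [<[z]>], [P] and [Q]; the first two factors normalize it, so only the one in [Q] moves
    [d]. *)
Lemma Sylow_cyclic_ext (wT : finGroupType) (W H P Q S : {group wT}) (z d : wT) (p :
  nat) :
  prime p -> W \subset 'N(H) -> H * <[z]> = W -> P <| W -> p.-group P -> P * Q = H ->
  d \in <[z]> -> p.-elt d -> p.-Sylow(W) S ->
  (logn p #|W| <= logn p #|P| + logn p #[coset H d])%N ->
  exists2 t, t \in Q & S :=: P <*> <[d ^ t]>.
Proof.
move=> p_pr nHW defW nPW pP defH dz pd sylS leW.
have zW : <[z]> \subset W by rewrite -defW mulG_subr.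
have HW : H \subset W by rewrite -defW mulG_subl.
have PH : P \subset H by rewrite -defH mulG_subl.
have QH : Q \subset H by rewrite -defH mulG_subr.
have dW : d \in W by apply: subsetP zW d dz.
have nPd : <[d]> \subset 'N(P) by rewrite cycle_subG (subsetP (normal_norm nPW)).
pose D := (P <*> <[d]>)%G.
have DE : D :=: P * <[d]> by apply: norm_joinEr.
have DW : D \subset W by rewrite join_subG (normal_sub nPW) cycle_subG.
have pD : p.-group D by rewrite /= norm_joinEr // pgroupM pP.
have sylD : p.-Sylow(W) D.
  rewrite pHallE DW /= p_part -[X in X == _](part_pnat_id pD) p_part; apply/eqP.
  congr (p ^ _)%N; apply/eqP; rewrite eqn_leq dvdn_leq_log ?cardSg ?cardG_gt0 //=.
  apply: leq_trans leW _.
  have nHD : D \subset 'N(H) := subset_trans DW nHW.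
  rewrite -(LagrangeI D H) lognM ?cardG_gt0 ?indexg_gt0 //.
  apply: leq_add; apply: dvdn_leq_log; rewrite ?cardG_gt0 ?indexg_gt0 //.
    by rewrite cardSg // subsetI PH joing_subl.
  rewrite -card_quotient // order_dvdG // mem_quotient //.
  by rewrite (subsetP (joing_subr _ _)) // cycle_id.
have [g gW SE] := Sylow_trans sylD sylS.
have [h [u [hH uz gE]]] : exists h u, [/\ h \in H, u \in <[z]> & g = u * h].
  have : g \in <[z]> * H.
    by rewrite (normC (subset_trans zW nHW)) defW.
  by case/mulsgP=> u h uz hH ->; exists h, u.
have [v [t [vP tQ hE]]] : exists v t, [/\ v \in P, t \in Q & h = v * t].
  by move: hH; rewrite -defH => /mulsgP[v t vP tQ ->]; exists v, t.
have tW : t \in W by rewrite (subsetP HW) ?(subsetP QH).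
exists t => //; rewrite SE gE hE !conjsgM.
have uW : u \in W := subsetP zW u uz.
have -> : D :^ u = D.
  rewrite conjYg -cycleJ (normsP (normal_norm nPW)) //.
  by rewrite conjgE (centsP (cycle_abelian z) d dz u uz) mulKg.
have -> : D :^ v = D by rewrite conjGid // (subsetP (joing_subl _ _)).
by rewrite conjYg -cycleJ (normsP (normal_norm nPW)).
Qed.

(** A valuation [m] is visible modulo [p ^ m.+1]. *)
Lemma logn_mod_eq p m (x : int) (l N : nat) : prime p -> x <> 0%R -> m = logn p `|x| ->
  (p ^ m.+1 %| N)%N -> (x = (Posz l) %[mod N])%Z -> (0 < l)%N /\ logn p l = m.
Proof.
move=> p_pr /eqP x0 mE pN /eqP; rewrite eqz_mod_dvd => NxL.
have x_gt0 : (0 < `|x|)%N by rewrite absz_gt0.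
have dE k : (k <= m.+1)%N -> (p ^ k %| l)%N = (k <= m)%N.
  move=> le_k; rewrite mE -pfactor_dvdn //.
  have pk : ((p ^ k)%N %| (x - (Posz l))%R)%Z.
    by apply: dvdz_trans NxL; rewrite dvdzE /=; apply: dvdn_trans pN; apply: dvdn_exp2l.
  rewrite -[(p ^ k %| l)%N]/((p ^ k)%N %| (Posz l))%Z -[(p ^ k %| `|x|)%N]/((p ^ k)%N %| x)%Z.
  by rewrite -[x in RHS](GRing.subrK (Posz l)) GRing.rpredDl.
have l_gt0 : (0 < l)%N.
  by case: posnP (dE m.+1 (leqnn _)) => // ->; rewrite dvdn0 ltnn.
split=> //; apply/eqP; rewrite eqn_leq -pfactor_dvdn // dE // leqnn andbT.
by rewrite leqNgt -pfactor_dvdn // dE // ltnn.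
Qed.

(** This excludes [p = 3] in [nat_exponent]. *)
Lemma dvdn3_cases f : (3 %| f * f.-1) || (3 %| f.+1).
Proof. by rewrite Euclid_dvdM //; lia. Qed.

Lemma expz_mod (z : int) (f N i : nat) : (z = f %[mod N])%Z ->
  ((z ^+ i)%R = Posz (f ^ i) %[mod N])%Z.
Proof. by move=> zf; rewrite -[Posz (f ^ i)]natz natrX natz -modzXm zf modzXm. Qed.

Lemma eqz_mod_dvdr (x y : int) (d N : nat) : (d %| N)%N ->
  (x = y %[mod N])%Z -> (x = y %[mod d])%Z.
Proof.
move=> dN /eqP; rewrite eqz_mod_dvd => xy; apply/eqP; rewrite eqz_mod_dvd.
by apply: dvdz_trans xy; rewrite dvdzE.
Qed.

(* Relations [x ^ z = x ^ alpha] in finite groups only see [alpha] modulo the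
   group orders, so [alpha] may be traded for a natural number [f]. *)
Lemma nat_exponent (alpha : int) (gamma p N : nat) (E := (alpha ^+ gamma)%R) :
  prime p -> odd p -> (0 < gamma)%N -> (E - 1)%R <> 0%R -> (p %| (E - 1)%R)%Z ->
  (alpha != 1 %[mod p])%Z -> (alpha != -1 %[mod p])%Z ->
  (0 < N)%N -> (p ^ (logn p `|(E - 1)%R|).+1 %| N)%N ->
  exists f : nat, [/\ (alpha = f %[mod N])%Z, (3 < p)%N,
    ~~ (p %| f * f.-1)%N, ~~ (p %| f.+1)%N
  & (1 < f ^ gamma)%N /\ logn p (f ^ gamma).-1 = logn p `|(E - 1)%R|].
Proof.
move=> p_pr p_odd gamma_gt0 E1 p_dvd alpha_mod1 alpha_modN1 N_gt0 pN'.
set m := logn p `|_| in pN' *.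
have [f fE] := int_nat_mod alpha N_gt0.
pose e := (f ^ gamma)%N.
have eE : (E = Posz e %[mod N])%Z := expz_mod gamma fE.
have pN : (p %| N)%N by apply: dvdn_trans pN'; rewrite expnS dvdn_mulr.
have fp := eqz_mod_dvdr pN fE; have ep := eqz_mod_dvdr pN eE.
have e_gt0 : (0 < e)%N.
  rewrite lt0n; apply/eqP=> e0; move: ep; rewrite e0 => /eqP.
  rewrite eqz_mod_dvd GRing.subr0 => pE.
  have : (p %| (E - (E - 1))%R)%Z by rewrite GRing.rpredB.
  by rewrite GRing.subKr dvdz1 /= => /eqP p1; move: p_pr; rewrite p1.
have [l_gt0 lE] : (0 < e.-1)%N /\ logn p e.-1 = m.
  apply: (@logn_mod_eq p m (E - 1)%R e.-1 N) => //.
  apply/eqP; rewrite eqz_mod_dvd.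
  have -> : (E - 1 - Posz e.-1 = E - Posz e)%R.
    by rewrite -[in RHS](prednK e_gt0) intS GRing.opprD GRing.addrA.
  by rewrite -eqz_mod_dvd; apply/eqP.
have eS : e = e.-1.+1 by rewrite prednK.
have pl : (p %| e.-1)%N.
  have : (0 < logn p e.-1)%N by rewrite lE logn_gt0 mem_primes p_pr absz_gt0 /=;
    apply/andP; split; [apply/eqP | exact: p_dvd].
  by rewrite logn_gt0 mem_primes => /and3P[].
have f_gt0 : (0 < f)%N by move: e_gt0; rewrite /e expn_gt0 eqn0Ngt gamma_gt0 orbF.
have pf : ~~ (p %| f * f.-1)%N.
  rewrite Euclid_dvdM // negb_or; apply/andP; split.
    apply/negP=> pdf; have pe : (p %| e)%N by rewrite Euclid_dvdX // pdf.
    move: pe; rewrite eS -addn1 dvdn_addr // dvdn1 => /eqP p1.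
    by move: p_pr; rewrite p1.
  apply: contra alpha_mod1; rewrite fp eqz_mod_dvd => pdf.
  by rewrite -(prednK f_gt0) intS GRing.addrC GRing.addKr.
have pf1 : ~~ (p %| f.+1)%N.
  apply: contra alpha_modN1; rewrite fp eqz_mod_dvd GRing.opprK => pdf.
  by rewrite GRing.addrC -intS.
have e_gt1 : (1 < e)%N by rewrite eS ltnS.
exists f; split=> //.
rewrite ltnNge; apply/negP=> p_le3.
have p3 : p = 3 by apply/eqP; rewrite eqn_leq p_le3 odd_prime_gt2.
by have := dvdn3_cases f; rewrite -p3 (negPf pf) (negPf pf1).
Qed.

Lemma gen_swap (gT : finGroupType) (a b c d : gT) :
  <<[set u in [:: b; a; c^-1; d^-1]]>> = <<[set u in [:: a; b; c; d]]>>.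
Proof.
have sub (u v w z : gT) :
    <<[set g in [:: v; u; w^-1; z^-1]]>> \subset <<[set g in [:: u; v; w; z]]>>.
  rewrite gen_subG; apply/subsetP=> g; rewrite inE !in_cons in_nil orbF.
  by case/or4P=> /eqP ->; rewrite ?groupV; apply: mem_seq_gen;
    rewrite !in_cons eqxx ?orbT.
apply/eqP; rewrite eqEsubset sub /=.
by have := sub b a c^-1 d^-1; rewrite !invgK.
Qed.

Lemma Aut_morphM (gT : finGroupType) (K : {group gT}) (s : {perm gT}) :
  s \in Aut K -> {in K &, {morph s : x y / x * y}}.
Proof. by move/Aut_morphic/morphicP. Qed.

Lemma Aut_conjV (gT : finGroupType) (K : {group gT}) (s : {perm gT}) c :
  s \in Aut K -> c \in K -> s c = c^-1 -> s c^-1 = c.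
Proof. by move=> sK cK sc; rewrite (morphV (autm sK) cK : s c^-1 = (s c)^-1) sc invgK.
  Qed.

Lemma squeeze_add (a b s A B : nat) : (a <= A)%N -> (b <= B)%N ->
  (A + B <= s)%N -> s = (a + b)%N -> [/\ a = A, b = B & s = (A + B)%N].
Proof. by move=> *; split; lia. Qed.

Theorem theorem4p12
  (alpha : int) (gamma p : nat)
  (gamma_gt0 : (0 < gamma)%N)
  (alpha_neq1 : (alpha ^+ gamma)%R <> 1%R)
  (p_prime : prime p) (p_odd : odd p)
  (p_dvd : (p %| (alpha ^+ gamma - 1)%R)%Z)
  (p_eq3 : p = 3 -> ((alpha ^+ gamma)%R != 7 %[mod 9])%Z)
  (alpha_mod1 : (alpha != 1 %[mod p])%Z)
  (alpha_modN1 : (alpha != -1 %[mod p])%Z)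
  (wT : finGroupType) (X Y Z : wT)
  (W_pres : presented [set: wT]%G [:: X; Y; Z] (W_rel alpha gamma))
  (gT : finGroupType) (A B : gT)
  (G_pres : presented [set: gT]%G [:: A; B] (G_rel alpha gamma))
  (G_nil : nilpotent [set: gT])
  (phi : {morphism [set: gT] >-> wT})
  (phiA : phi A = X) (phiB : phi B = Y)
  (J Np : {group gT})
  (J_Sylow : p.-Sylow([set: gT]) J)
  (Np_def : Np :=: 'ker phi :&: J)
  (Wp : {group wT})
  (Wp_Sylow : p.-Sylow([set: wT]) Wp)
  (iota : {morphism J / Np >-> wT})
  (iota_def : forall x, x \in J -> iota (coset Np x) = phi x)
  (a b c : gT)
  (a_def : a = Sylow_proj p [set: gT]%G A)
  (b_def : b = Sylow_proj p [set: gT]%G B)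
  (c_def : c = [~ a, b])
  (a0 b0 c0 : coset_of Np)
  (a0_def : a0 = coset Np a) (b0_def : b0 = coset Np b) (c0_def : c0 = coset Np c)
  (m n k q : nat)
  (m_def : m = logn p `|(alpha ^+ gamma - 1)%R|%N)
  (n_def : n = logn p gamma)
  (k_def : gamma = (p ^ n * k)%N)
  (q_def : q = #|[set: gT] / J|) :
  [/\ Np :=: 'Z_3(J),
      J / Np \isog Heis 'Z_(p ^ m),
      #|J / Np| = (p ^ (3 * m))%N,
      presented (J / Np)%G [:: a0; b0; c0] (Heis_rel (p ^ m))
    & [/\ 'injm iota, iota @* (J / Np) <| Wp,
          cyclic (Wp / (iota @* (J / Np))),
          #|Wp| = (p ^ (3 * m + n))%N
        & exists2 d0 : wT, d0 \in Wp
          & [/\ presented Wp [:: iota a0; iota b0; iota c0; d0]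
                  (Wp_rel alpha (p ^ m) (p ^ n) q (q * k)),
                (forall w, w \in Wp ->
                   exists! e : 'I_(p ^ m) * 'I_(p ^ m) * 'I_(p ^ m) * 'I_(p ^ n),
                     let: (e1, e2, e3, e4) := e in
                     w = iota a0 ^+ e1 * iota b0 ^+ e2 * iota c0 ^+ e3 * d0 ^+ e4)
              & exists (sigma : {perm gT}) (sigma0 : {perm coset_of Np})
                       (tau : {perm wT}),
                  [/\ [/\ sigma \in Aut J, sigma a = b, sigma b = a,
                          sigma c = c^-1 & sigma c^-1 = c],
                      [/\ sigma0 \in Aut (J / Np),
                          {in J, forall x, sigma0 (coset Np x) = coset Np (sigma x)},
                          sigma0 a0 = b0, sigma0 b0 = a0
                        & sigma0 c0 = c0^-1 /\ sigma0 c0^-1 = c0]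
                    & [/\ tau \in Aut Wp,
                          {in J / Np, forall u, tau (iota u) = iota (sigma0 u)},
                          tau d0 = d0^-1 & tau d0^-1 = d0]]]]].
Proof.

(* Passage to natural exponents *)
have p_pr := p_prime.
pose G := [set: gT]%G; pose W := [set: wT]%G.
set E := (alpha ^+ gamma)%R in alpha_neq1 p_dvd p_eq3 m_def *.
have E1 : (E - 1)%R <> 0%R by move/eqP; rewrite GRing.subr_eq0 => /eqP.
have m_gt0 : (0 < m)%N.
  rewrite m_def logn_gt0 mem_primes p_pr absz_gt0 /=.
  by apply/andP; split; [apply/eqP | exact: p_dvd].
set M := (p ^ m)%N.
have M_gt0 : (0 < M)%N by rewrite expn_gt0 prime_gt0.
have M_gt1 : (1 < M)%N by rewrite -(exp1n m) ltn_exp2r // prime_gt1.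
have ME : (M %| (E - 1)%R)%Z.
  by rewrite dvdzE /= /M m_def; apply: pfactor_dvdnn.
(* Both group orders divide [N], so powers in [gT] and [wT] depend on exponents modulo [N] only; the
   factor [p ^ m.+1] preserves the valuation [m]. *)
pose N := (#|gT| * #|wT| * p ^ m.+1)%N.
have N_gt0 : (0 < N)%N.
  by rewrite !muln_gt0 -!cardsT !cardG_gt0 expn_gt0 prime_gt0.
have pN : (p ^ (logn p `|(E - 1)%R|).+1 %| N)%N by rewrite -m_def dvdn_mull.
have [f [fE p_gt3 pf pf1 [e_gt1 lE]]] := nat_exponent p_prime p_odd gamma_gt0 E1
  p_dvd alpha_mod1 alpha_modN1 N_gt0 pN.
pose e := (f ^ gamma)%N; rewrite -/e -m_def in e_gt1 lE.
have eE : (E = Posz e %[mod N])%Z := expz_mod gamma fE.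
have e_gt0 : (0 < e)%N := ltnW e_gt1.
have l_gt0 : (0 < e.-1)%N by rewrite -ltnS prednK.
have eS : e = e.-1.+1 by rewrite prednK.
have pl : (p %| e.-1)%N.
  by move: m_gt0; rewrite -lE logn_gt0 mem_primes => /and3P[].
have gT_N : (#|gT| %| N)%N by rewrite /N -mulnA dvdn_mulr.
have wT_N : (#|wT| %| N)%N by rewrite /N mulnAC dvdn_mull.
have [genW [XZ ZY ZX] _] := W_pres.
rewrite (expgz_card _ wT_N fE) in XZ; rewrite (expgz_card _ wT_N fE) in ZY.
have [genG [AC CB] _] := G_pres.
rewrite (expgz_card _ gT_N eE) in AC; rewrite (expgz_card _ gT_N eE) in CB.
have nilG : nilpotent G by [].
have inG x : x \in G by rewrite inE.

(* The Sylow subgroup [J] and its generators *)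
have aE : a = A.`_p by rewrite a_def (Sylow_projE p nilG).
have bE : b = B.`_p by rewrite b_def (Sylow_projE p nilG).
pose pi := Morphism (consttM_nil p nilG).
have piE x : pi x = x.`_p by [].
have cE : c = [~ A, B].`_p by rewrite c_def aE bE -!piE -morphR.
have ac : a ^ c = a ^+ e by rewrite aE cE -!piE -morphJ // AC morphX.
have cb : c * b * c^-1 = b ^+ e.
  by rewrite bE cE -!piE -morphV // -!morphM // CB morphX.
have defJ : J :=: 'O_p(G) by apply: nilpotent_Hall_pcore.
have inJ x : (x \in J) = p.-elt x.
  by rewrite defJ (mem_Hall_pcore (nilpotent_pcore_Hall p nilG)).
have aJ : a \in J by rewrite inJ aE p_elt_constt.
have bJ : b \in J by rewrite inJ bE p_elt_constt.
have cJ : c \in J by rewrite c_def groupR.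
have genJ : <<[set a; b]>> = J.
  apply/eqP; rewrite eqEsubset gen_subG; apply/andP; split.
    by apply/subsetP=> x /set2P[] ->.
  apply/subsetP=> x; rewrite inJ => px.
  have -> : x = pi x by rewrite piE constt_p_elt.
  have : pi x \in pi @* <<[set y in [:: A; B]]>> by rewrite genG mem_morphim.
  rewrite morphim_gen ?subsetT //; apply: (subsetP (genS _)).
  apply/subsetP=> _ /morphimP[y _ + ->]; rewrite !inE piE aE bE.
  by case/orP=> /eqP->; rewrite eqxx ?orbT.
have pJ : p.-group J by case/and3P: J_Sylow.

(* The Heisenberg relations in the image of [J] *)
pose x := phi a; pose y := phi b; pose P := (phi @* J)%G; pose H := (phi @* G)%G.
have xE : x = X.`_p by rewrite /x aE morph_constt // phiA.
have yE : y = Y.`_p by rewrite /y bE morph_constt // phiB.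
have phic : phi c = [~ x, y] by rewrite c_def morphR.
have phicE : phi c = (Z ^+ gamma).`_p.
  by rewrite cE morph_constt // morphR // phiA phiB ZX.
have xz : x ^ Z = x ^+ f by rewrite xE -consttJ XZ consttX.
have yz : Z * y * Z^-1 = y ^+ f.
  have conjV (u : wT) : Z * u * Z^-1 = u ^ Z^-1 by rewrite conjgE invgK mulgA.
  by rewrite yE conjV -consttJ -conjV ZY consttX.
(* [[~ x, y]] is the [p]-part of [Z ^+ gamma], hence a power of [Z]. *)
have zc : commute Z [~ x, y].
  by rewrite -phic phicE; apply/commuteX/commuteX.
have xc : x ^ [~ x, y] = x ^+ e.-1.+1.
  by rewrite -eS -phic -morphJ // ac morphX.
have yc : [~ x, y] * y * [~ x, y]^-1 = y ^+ e.-1.+1.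
  by rewrite -eS -phic -morphV // -!morphM // cb morphX.
have px : p.-elt x by rewrite xE p_elt_constt.
have py : p.-elt y by rewrite yE p_elt_constt.
have relP : Heis_rel M [:: x; y; [~ x, y]].
  have := wamsley_Heis_rel p_pr p_odd l_gt0 pl pf pf1 px py xc yc xz yz zc.
  by rewrite lE.
have genP : <<[set u in [:: x; y; [~ x, y]]]>> = P.
  apply/eqP; rewrite eqEsubset gen_subG; apply/andP; split.
    apply/subsetP=> u; rewrite !inE -phic.
    by case/or3P=> /eqP->; rewrite mem_morphim.
  rewrite /= -genJ morphim_gen ?subsetT // gen_subG.
  apply/subsetP=> _ /morphimP[u _ /set2P[] -> ->]; apply: mem_seq_gen.
    exact: mem_head.
  by rewrite !inE eqxx orbT.
have cardP_le : (#|P| <= M ^ 3)%N := card_Heis_le M_gt0 relP genP.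

(* The group [W] as a cyclic extension of the image of [G] *)
have genH : H :=: <<[set X; Y]>>.
  have -> : H :=: phi @* <<[set u in [:: A; B]]>> by rewrite genG.
  rewrite morphim_gen ?subsetT //; congr <<_>>; apply/setP=> u.
  apply/morphimP/set2P => [[v _ + ->]|[] ->]; first by rewrite !inE => /orP[] /eqP->;
    [left | right].
    by exists A; rewrite ?inE ?eqxx.
  by exists B; rewrite ?inE ?eqxx ?orbT.
have genH' : H :=: <[X]> <*> <[Y]> by rewrite genH [RHS]joing_idl joing_idr.
have ZH : Z \in 'N(H).
  by rewrite genH' -cycle_subG normsY // cycle_subG (cycle_normV XZ, cycle_norm ZY).
have [XH YH] : X \in H /\ Y \in H by rewrite -phiA -phiB !mem_morphim.
have defW : H * <[Z]> = W.
  rewrite -norm_joinEr ?cycle_subG //; apply/eqP; rewrite eqEsubset subsetT /=.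
  rewrite -genW gen_subG; apply/subsetP=> u; rewrite !inE.
  have sH := subsetP (joing_subl H <[Z]>).
  case/or3P=> /eqP->; [exact: sH | exact: sH |].
  by rewrite (subsetP (joing_subr _ _)) ?cycle_id.
have nHW : W \subset 'N(H).
  by rewrite -defW mul_subG ?normG ?cycle_subG.
have ZgH : Z ^+ gamma \in H.
  by rewrite ZX groupR.
have pP : p.-group P by apply: morphim_pgroup.
have sylP : p.-Sylow(H) P by apply: morphim_pHall; rewrite ?subsetT.
have nilH : nilpotent H by apply: morphim_nil.
have nPW : P <| W.
  rewrite (nilpotent_Hall_pcore nilH sylP); apply: (char_normal_trans (pcore_char p H)).
  by rewrite /normal subsetT.

(* The [p]-parts of the orders *)
have dW : (M * M * (gamma * M) %| #|W|)%N.
  by rewrite cardsT; apply: card_wamsley W_pres.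
have ordZ : (#[coset H Z] %| gamma)%N.
  by rewrite order_dvdn -morphX //= coset_id.
have cardW : #|W| = (#|H| * #[coset H Z])%N.
  rewrite -(Lagrange (subsetT H)) -card_quotient //; congr (_ * _)%N.
  by rewrite -[in LHS]defW quotientMidl quotient_cycle.
have lognH : logn p #|H| = logn p #|P|.
  by rewrite (card_Hall sylP) p_part pfactorK.
have lognZ : (logn p #[coset H Z] <= n)%N.
  by rewrite n_def dvdn_leq_log.
have lognW : (3 * m + n <= logn p #|W|)%N.
  have <- : logn p (M * M * (gamma * M)) = (3 * m + n)%N.
    by rewrite !lognM ?muln_gt0 ?M_gt0 ?gamma_gt0 // pfactorK // -n_def (addnC n)
      addnA !mulSn addn0 addnA.
  by rewrite dvdn_leq_log ?cardG_gt0.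
have [lognP lognZE lognWE] : [/\ logn p #|P| = (3 * m)%N, logn p #[coset H Z] = n
   & logn p #|W| = (3 * m + n)%N].
  have cardPp : #|P| = (p ^ logn p #|P|)%N by rewrite -p_part part_pnat_id.
  apply: squeeze_add => //; last by rewrite cardW lognM ?cardG_gt0 // lognH.
  by move: cardP_le; rewrite {1}cardPp /M -expnM leq_exp2l ?prime_gt1 // mulnC.
have cardP : #|P| = (M ^ 3)%N.
  by rewrite -[LHS](part_pnat_id pP) p_part lognP /M -expnM mulnC.

(* The quotient of [J] by [Np] and the third centre *)
have nNJ : Np <| J.
  have -> : Np = (J :&: 'ker phi)%G by apply: val_inj; rewrite /= Np_def setIC.
  by apply: normalGI (ker_normal phi); apply: subsetT.
have nN u : u \in J -> u \in 'N(Np) by apply/subsetP/normal_norm.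
have aN : a0 \in J / Np by rewrite a0_def mem_quotient.
have bN : b0 \in J / Np by rewrite b0_def mem_quotient.
have cN : c0 \in J / Np by rewrite c0_def mem_quotient.
have ia : iota a0 = x by rewrite a0_def iota_def.
have ib : iota b0 = y by rewrite b0_def iota_def.
have ic : iota c0 = [~ x, y] by rewrite c0_def iota_def.
have c0E : c0 = [~ a0, b0] by rewrite c0_def a0_def b0_def c_def morphR ?nN.
have inj_iota : 'injm iota.
  apply/subsetP=> u uK; have /morphimP[v vN vJ uE] := dom_ker uK.
  have := mker uK; rewrite uE iota_def // => phiv; apply/set1P/coset_id.
  by rewrite Np_def inE vJ andbT; apply/kerP.
have iotaJ : iota @* (J / Np) = P.
  apply/setP=> u; apply/morphimP/morphimP => [[v vJ] |[v _ vJ ->]].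
    by case/morphimP: vJ => w wN wJ -> _ ->; exists w; rewrite ?inE // iota_def.
  by exists (coset Np v); rewrite ?mem_quotient //= iota_def.
have relN : Heis_rel M [:: a0; b0; c0].
  have [_ xc' yc' [xM yM cM]] := relP.
  split=> //.
  - by apply: (injmP inj_iota); rewrite ?groupJ // morphJ // ia ic.
  - by apply: (injmP inj_iota); rewrite ?groupJ // morphJ // ib ic.
  by split; apply: (injmP inj_iota); rewrite ?groupX // morphX // morph1 ?ia ?ib ?ic.
have genN : <<[set u in [:: a0; b0; c0]]>> = J / Np.
  apply/eqP; rewrite eqEsubset gen_subG; apply/andP; split.
    by apply/subsetP=> u; rewrite !inE => /or3P[] /eqP->.
  have -> : J / Np = <<[set a; b]>> / Np by rewrite genJ.
  rewrite /quotient morphim_gen ?gen_subG; last first.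
    by apply/subsetP=> u /set2P[] ->; apply: nN.
  apply/subsetP=> _ /morphimP[u _ /set2P[] -> ->] /=; rewrite -?a0_def -?b0_def.
    by apply: mem_seq_gen; apply: mem_head.
  by apply: mem_seq_gen; rewrite !inE eqxx orbT.
have cardN : #|J / Np| = (M ^ 3)%N.
  by rewrite -(card_injm inj_iota) // iotaJ.
have presN : presented (J / Np)%G [:: a0; b0; c0] (Heis_rel M).
  by apply: presented_Heis => //; rewrite cardN.
have ac1 : a ^ [~ a, b] = a ^+ e.-1.+1 by rewrite -c_def -eS.
have bc1 : [~ a, b] * b * [~ a, b]^-1 = b ^+ e.-1.+1 by rewrite -c_def -eS.
have relZ : Heis_rel M [:: coset 'Z_3(J) a; coset 'Z_3(J) b; coset 'Z_3(J) c].
  rewrite c_def; have := macdonald_Heis_rel p_pr p_odd p_gt3 l_gt0 pl pJ genJ ac1 bc1.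
  by rewrite lE.
have c_order t : c ^+ t \in 'Z_3(J) -> (M %| t)%N.
  rewrite c_def => ctZ.
  have := fun H => dvdn_commg_Z3 p_pr p_odd p_gt3 l_gt0 pl pJ genJ ac1 H ctZ;
    rewrite lE; apply=> i ai1.
  by apply: (dvdn_order_macdonald p_pr p_gt3 ME m_gt0 G_pres); rewrite -aE.
have NZ : Np :=: 'Z_3(J).
  apply: (eq_Z3_of_presented M_gt0 nNJ genJ cJ _ relZ c_order).
  by rewrite -a0_def -b0_def -c0_def.

(* The Sylow subgroup of [W] and the element [d0] *)
pose Q := (phi @* 'O_p^'(G))%G.
have /dprodP[_ defG cPQ _] := nilpotent_pcoreC p nilG.
have defH : P * Q = H.
  by rewrite /= -morphimMl ?subsetT // defJ defG.
have cQ u t : u \in P -> t \in Q -> u ^ t = u.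
  move=> /morphimP[u' _ uJ ->] /morphimP[t' _ tQ ->]; rewrite -morphJ //.
  congr (phi _); apply/conjg_fixP/commgP/commute_sym.
  by apply: (centsP cPQ) => //; rewrite -defJ.
have qE : q = #|G : J| by rewrite q_def card_quotient // normal_norm //
  defJ pcore_normal.
have p_q : ~~ (p %| q)%N.
  by rewrite qE -p'natE //; case/and3P: J_Sylow.
have p_k : ~~ (p %| k)%N.
  apply/negP=> /dvdnP[k' kE].
  have : (p ^ n.+1 %| gamma)%N by rewrite k_def kE expnSr mulnCA dvdn_mull.
  by rewrite pfactor_dvdn // -n_def ltnn.
(* [q] is the [p']-part of the order of [G], so it kills the [p']-part of [[~ A, B]]. *)
have Cq : [~ A, B] ^+ q = c ^+ q.
  rewrite -{1}(consttC p [~ A, B]) expgMn; last exact: (commuteX2 _ _ (commute_refl _)).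
  rewrite -cE (_ : [~ A, B].`_p^' ^+ q = 1) ?mulg1 //.
  apply/eqP; rewrite -order_dvdn order_constt.
  have -> : q = (#|G|`_p^')%N.
    apply/eqP; rewrite qE -(eqn_pmul2l (cardG_gt0 J)) Lagrange ?subsetT //.
    by rewrite (card_Hall J_Sylow) partnC.
  by rewrite partn_dvd ?cardG_gt0 // order_dvdG.
pose dz := Z ^+ (q * k)%N.
have dzX : dz ^+ (p ^ n) = phi c ^+ q.
  by rewrite /dz -expgM -mulnA (mulnC k) -k_def mulnC expgM ZX -morphX // -Cq morphX //
    morphR // phiA phiB.
have pdz : p.-elt dz.
  have : p.-elt (dz ^+ (p ^ n)) by rewrite dzX p_eltX // phic -phic morph_p_elt // -inJ.
  rewrite p_elt_exp => dvd_p.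
  rewrite /p_elt -(partnC p (order_gt0 dz)) (_ : #[dz]`_p^' = 1)%N ?muln1 ?part_pnat //.
  apply: (@pnat_1 p); last exact: part_pnat.
  by apply: pnat_dvd dvd_p _; rewrite pnatX pnat_id.
(* [q * k] is prime to [p], so [dz] and [Z] have orders with the same [p]-part modulo [H]. *)
have leW : (logn p #|W| <= logn p #|P| + logn p #[coset H dz])%N.
  rewrite lognWE lognP leq_add2l -lognZE /dz morphX // orderXgcd.
  set o := #[coset H Z]; have dg := dvdn_gcdl o (q * k).
  rewrite -{1}(divnK dg) mulnC logn_Gauss // prime_coprime //.
  apply: contra (_ : ~~ (p %| q * k)%N); last by rewrite Euclid_dvdM // negb_or p_q.
  by move/dvdn_trans; apply; apply: dvdn_gcdr.
have [t tQ WpE] : exists2 t, t \in Q & Wp :=: P <*> <[dz ^ t]>.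
  by apply: (Sylow_cyclic_ext p_pr nHW defW nPW pP defH _ pdz Wp_Sylow leW);
    apply: mem_cycle.
(* As [t] centralizes [P], [d0] acts on [P] exactly as [dz] does. *)
pose d0 := dz ^ t.
have xP : x \in P by rewrite mem_morphim.
have yP : y \in P by rewrite mem_morphim.
have xd : x ^ d0 = x ^+ (f ^ (q * k)).
  rewrite /d0 -{1}(cQ x t) // -conjJg -[x]expg1 (conj_pow _ _ xz) mul1n expg1.
  by rewrite cQ // groupX.
have yd : d0 * y * d0^-1 = y ^+ (f ^ (q * k)).
  have -> : d0 * y * d0^-1 = y ^ d0^-1 by rewrite conjgE invgK mulgA.
  have yz' : y ^ Z^-1 = y ^+ f by rewrite conjgE invgK mulgA.
  rewrite /d0 -conjVg -{1}(cQ y t) // -conjJg -expVgn -[y]expg1 (conj_pow _ _ yz').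
  by rewrite mul1n expg1 cQ // groupX.
have dX : d0 ^+ (p ^ n) = [~ x, y] ^+ q.
  by rewrite -conjXg dzX phic cQ // groupX // groupR.

(* Presentation and normal form of [Wp] *)
have qkE : ((alpha ^+ (q * k))%R = Posz (f ^ (q * k)) %[mod N])%Z := expz_mod _ fE.
have relW : Wp_rel alpha M (p ^ n) q (q * k) [:: x; y; [~ x, y]; d0].
  by split=> //; rewrite !(expgz_card _ wT_N qkE).
have genWp : <<[set u in [:: x; y; [~ x, y]; d0]]>> = Wp.
  apply/eqP; rewrite eqEsubset gen_subG WpE join_subG cycle_subG; apply/and3P; split.
  - apply/subsetP=> u; rewrite inE !in_cons in_nil orbF => us.
    have sP := subsetP (joing_subl P <[d0]>).
    case/or4P: us => /eqP ->; [exact: sP | exact: sP | by rewrite sP ?groupR |].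
    by rewrite (subsetP (joing_subr _ _)) ?cycle_id.
  - rewrite -genP gen_subG; apply/subsetP=> u; rewrite inE => us.
    by apply: mem_seq_gen; move: us; rewrite !inE => /or3P[] ->; rewrite ?orbT.
  - by apply: mem_seq_gen; rewrite !inE eqxx !orbT.
have cardWp : #|Wp| = (M ^ 3 * p ^ n)%N.
  by rewrite (card_Hall Wp_Sylow) p_part lognWE expnD /M -expnM (mulnC 3).
have PWp : P <| Wp.
  by apply: normalS nPW; rewrite ?subsetT // WpE joing_subl.
(* The product is [(f ^ gamma) ^ (q * k)], and [f ^ gamma] is 1 modulo [M]. *)
have AB : (f ^ (q * k) * f ^ (q * k * gamma.-1) = 1 %[mod M])%N.
  rewrite -expnD -{1}(muln1 (q * k)%N) -mulnDr add1n prednK // (mulnC _ gamma) expnM.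
  have Me : (M %| e.-1)%N by have := pfactor_dvdnn p e.-1; rewrite lE.
  have e1 : e = 1 %[mod M] by apply/eqP; rewrite eqn_mod_dvd // subn1.
  by rewrite -/e -modnXm e1 modnXm exp1n.
have qkM : ((alpha ^+ (q * k))%R = Posz (f ^ (q * k)) %[mod M])%Z.
  by apply: eqz_mod_dvdr qkE; rewrite dvdn_mull // /M expnSr dvdn_mulr.
have L_gt0 : (0 < p ^ n)%N by rewrite expn_gt0 prime_gt0.
have cardWp' : (M ^ 3 * p ^ n <= #|Wp|)%N by rewrite cardWp.
have presWp := presented_normal M_gt0 L_gt0 qkM AB genWp relW cardWp'.
have uniqWp := normal_of_unique M_gt0 L_gt0 qkM AB genWp relW cardWp'.
split=> //.
- exact: isog_Heis presN cardN.
- by rewrite cardN /M -expnM mulnC.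
split=> //.
- by rewrite iotaJ.
- rewrite iotaJ WpE quotientYidl ?quotient_cyclic ?cycle_cyclic //.
  by rewrite cycle_subG (subsetP (normal_norm nPW)).
- by rewrite cardWp /M -expnM (mulnC m) -expnD.
exists d0; first by rewrite WpE (subsetP (joing_subr _ _)) ?cycle_id.
rewrite ia ib ic; split=> //.
  move=> w /uniqWp[[[[e1 e2] e3] e4] [-> uniq_e]].
  exists (e1, e2, e3, e4); split=> // -[[[e1' e2'] e3'] e4'] wE.
  exact: (uniq_e (e1', e2', e3', e4')).

(* The three compatible automorphisms *)
have [_ [AC0 CB0] _] := G_pres.
have [sG sGA [sGa sGb]] : exists2 sG : {perm gT}, sG \in Aut G & map sG [:: A;
  B] = [:: B; A].
  apply: (presented_aut G_pres).
    split; rewrite -(invgR A B); first by rewrite conjgE invgK mulgA.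
    by rewrite invgK -mulgA.
  rewrite -genG; congr <<_>>; apply/setP=> u.
  by rewrite !inE orbC.
(* The swap of [A] and [B] preserves [J], the set of [p]-elements of [G], and exchanges the
   [p]-parts [a] and [b]. *)
pose fG := restrm (subsetT J) (autm sGA).
have inj_fG : 'injm fG := injm_restrm (subsetT J) (injm_autm sGA).
have fGJ : fG @* J = J.
  apply/eqP; rewrite eqEcard (card_injm inj_fG) // leqnn andbT.
  apply/subsetP=> _ /morphimP[u _ uJ ->]; rewrite inJ.
  by apply: (morph_p_elt (autm sGA) (inG u)); rewrite -inJ.
pose sigma := aut inj_fG fGJ.
have sigmaA : sigma \in Aut J by apply: Aut_aut.
have sigmaE u : u \in J -> sigma u = sG u by move=> uJ; apply: autE.
have sa : sigma a = b.
  by rewrite sigmaE // aE bE (morph_constt (autm sGA) p (inG A) : sG _ = (sG A).`_p)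
    sGa.
have sb : sigma b = a.
  by rewrite sigmaE // aE bE (morph_constt (autm sGA) p (inG B) : sG _ = (sG B).`_p)
    sGb.
have sc : sigma c = c^-1.
  by rewrite c_def (morphR (autm sigmaA) aJ bJ : sigma _ = [~ sigma a, sigma b])
    sa sb invgR.
have [sigma0 s0A [s0a s0b s0c]] : exists2 s0 : {perm coset_of Np},
    s0 \in Aut (J / Np) & map s0 [:: a0; b0; c0] = [:: b0; a0; c0^-1].
  apply: (presented_aut presN).
    have /Wp_rel_swap := (Heis_Wp_rel M a0 b0 c0).1 relN.
    by rewrite invg1 => /Heis_Wp_rel.
  have gen3 (u v w : coset_of Np) :
      <<[set g in [:: u; v; w]]>> = <<[set g in [:: u; v; w; w]]>>.
    by congr <<_>>; apply/setP=> g; rewrite !inE orbb.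
  by rewrite gen3 gen_swap -gen3.
have compat0 : {in J, forall u, sigma0 (coset Np u) = coset Np (sigma u)}.
  have := @eq_morph_gen _ _ [set a; b] (fun u => sigma0 (coset Np u))
    (fun u => coset Np (sigma u)).
  have sJ u : u \in J -> sigma u \in J by exact: Aut_closed.
  rewrite genJ; apply => [u v uJ vJ|u v uJ vJ|u /set2P[] ->].
  - by rewrite (morphM (coset_morphism Np)) ?nN // (Aut_morphM s0A) ?mem_quotient.
  - by rewrite (Aut_morphM sigmaA) // (morphM (coset_morphism Np)) ?nN ?sJ.
  - by rewrite -a0_def s0a sa.
  - by rewrite -b0_def s0b sb.
have [tau tA [ta tb tc td]] : exists2 tau : {perm wT},
    tau \in Aut Wp & map tau [:: x; y; [~ x, y]; d0] = [:: y; x; [~ x, y]^-1; d0^-1].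
  apply: (presented_aut presWp); first exact: Wp_rel_swap.
  by rewrite gen_swap.
have d0Wp : d0 \in Wp by rewrite WpE (subsetP (joing_subr _ _)) ?cycle_id.
have PsWp := subsetP (normal_sub PWp).
exists sigma, sigma0, tau; split.
- by split=> //; exact: (Aut_conjV sigmaA cJ sc).
- by split=> //; split=> //; exact: (Aut_conjV s0A cN s0c).
split=> //; last exact: (Aut_conjV tA d0Wp td).
have := @eq_morph_gen _ _ [set u in [:: a0; b0;
  c0]] (fun u => tau (iota u)) (fun u => iota (sigma0 u)).
have iWp u : u \in J / Np -> iota u \in Wp.
  by move=> uJ; rewrite PsWp // -iotaJ mem_morphim.
rewrite genN; apply => [u v uJ vJ|u v uJ vJ|u].
- by rewrite morphM // (Aut_morphM tA) ?iWp.
- by rewrite (Aut_morphM s0A) // morphM // (Aut_closed s0A).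
rewrite inE !in_cons in_nil orbF => /or3P[] /eqP->.
- by rewrite ia ta s0a ib.
- by rewrite ib tb s0b ia.
- by rewrite ic tc s0c morphV // ic.
Qed.
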